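(* Let $n\ge1$ and $0<p<\infty$. There is a finite constant $B_{p,n}$ such that for all nonnegative functions $F_1,\dots,F_{n+1}\in L^p(\mathbb{S}^n)$, $$\prod_{j=1}^{n+1}\|F_j\|_{L^p(\mathbb{S}^n)}\le B_{p,n}\,\sup_{s_1,\dots,s_{n+1}\in\mathbb{S}^n}\ \prod_{j=1}^{n+1}F_j(s_j)\,\det(s_1,\dots,s_{n+1})^{\frac{n+1}{p}},$$ where $\det(s_1,\dots,s_{n+1})$ is the absolute value of the determinant of the $(n+1)\times(n+1)$ matrix $(s_1,\dots,s_{n+1})$. The best constant $B_{p,n}$ is obtained when the $F_j$ are (nonzero) constant functions, and its value is $B_{p,n}=|\mathbb{S}^n|^{\frac{n+1}{p}}$.
   Context: $\mathbb{S}^n$ is the unit sphere in $\mathbb{R}^{n+1}$ with its surface measure, and $|\mathbb{S}^n|$ is its surface area. $\|F\|_{L^p}=(\int|F|^p)^{1/p}$ (also for $p<1$). $\sup$ denotes the essential supremum with respect to the product of the surface measures. *)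

(* Defs.v *)
From HB Require Import structures.
From mathcomp Require Import all_boot all_order all_algebra.
From mathcomp Require Import all_classical all_reals all_analysis.
From mathcomp Require Import measurable_realfun ess_sup_inf.

Set Implicit Arguments.
Unset Strict Implicit.
Unset Printing Implicit Defensive.

Import Order.TTheory GRing.Theory Num.Theory.
Import numFieldNormedType.Exports.

Local Open Scope classical_set_scope.
Local Open Scope ring_scope.

Section power_measure.
Context d (T : measurableType d) (R : realType).
Variable mu : {sigma_finite_measure set T -> \bar R}.
Local Open Scope ereal_scope.

(* n-fold product of mu with itself, as an iterated integral. *)
Fixpoint power_measure n : set (n.-tuple T) -> \bar R :=
  match n with
  | 0 => \d_([tuple] : 0.-tuple T)
  | n'.+1 => fun A =>
      \int[mu]_x @power_measure n' [set t : n'.-tuple T | A [tuple of x :: t]]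
  end.

Let pack d' (U : measurableType d') (m : set U -> \bar R) :
  m set0 = 0 -> (forall A, 0 <= m A) -> semi_sigma_additive m ->
  sigma_finite setT m ->
  exists m' : {sigma_finite_measure set U -> \bar R}, m = m'.
Proof.
move=> h0 h1 h2 h3.
pose M := isMeasure.Build d' U R m h0 h1 h2.
pose m1 : {measure set U -> \bar R} := HB.pack m M.
pose S := Measure_isSigmaFinite.Build d' U R m1 h3.
pose m2 : {sigma_finite_measure set U -> \bar R} := HB.pack m M S.
by exists m2.
Qed.

Let pcons n (w : T * n.-tuple T) : n.+1.-tuple T := [tuple of w.1 :: w.2].

Let mpcons n : measurable_fun setT (@pcons n).
Proof. exact: measurable_cons. Qed.

Let power_measure_pack n :
  exists m' : {sigma_finite_measure set (n.-tuple T) -> \bar R},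
    @power_measure n = m'.
Proof.
elim: n => [|n [m' mE]].
  apply: pack => /=.
  - exact: measure0.
  - exact: measure_ge0.
  - exact: measure_semi_sigma_additive.
  - exact: sigma_finiteT.
have E : @power_measure n.+1 = pushforward (mu \x m') (@pcons n).
  apply/funext => A; rewrite /= mE /pushforward /product_measure1.
  apply: eq_integral => x _ /=; congr (m' _).
  by apply/seteqP; split=> t; rewrite /xsection /= inE.
have [m EM] : exists m : {measure set (n.+1.-tuple T) -> \bar R},
    pushforward (mu \x m') (@pcons n) = m.
  pose Q := measure_function_pushforward__canonical__measure_function_Measure (mu \x m')%E (@mpcons n).
  by exists Q.
rewrite E; apply: pack; rewrite ?EM.
- exact: measure0.
- exact: measure_ge0.
- exact: measure_semi_sigma_additive.
rewrite -EM.
have [H HT Hf] : sigma_finite setT (mu \x m').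
  have /sigma_finiteP[F [TF ndF Foo]] := sigma_finiteT mu.
  have /sigma_finiteP[G [TG ndG Goo]] := sigma_finiteT m'.
  exists (fun k => F k `*` G k).
    rewrite -setXTT TF TG predeqE => -[x y]; split.
      move=> [/= [i _ Fnx] [k _ Gky]]; exists (maxn i k) => //; split.
      - by move: x Fnx; exact/subsetPset/ndF/leq_maxl.
      - by move: y Gky; exact/subsetPset/ndG/leq_maxr.
    by move=> [i _ []/= ? ?]; split; exists i.
  move=> k; have [? ?] := Foo k; have [? ?] := Goo k.
  split; first exact: measurableX.
  by rewrite product_measure1E// lte_mul_pinfty// ge0_fin_numE.
pose u (t : n.+1.-tuple T) := (thead t, [tuple of behead t]).
have mu_ : measurable_fun setT u.
  apply/measurable_fun_pairP; split.
    exact: measurable_tnth.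
  exact: measurable_behead.
have uK w : u (@pcons n w) = w.
  by case: w => x t; rewrite /u /pcons theadE; congr (_, _); exact/val_inj.
exists (fun k => u @^-1` H k).
  by rewrite -preimage_bigcup -HT preimage_setT.
move=> k; have [mH fH] := Hf k; split.
  by rewrite -[X in measurable X]setTI; exact: mu_.
rewrite /pushforward (_ : _ @^-1` _ = H k) //.
by apply/seteqP; split => w /=; rewrite uK.
Qed.

Variable n : nat.

Let pm0 : @power_measure n set0 = 0.
Proof. by have [m ->] := power_measure_pack n. Qed.

Let pm_ge0 A : 0 <= @power_measure n A.
Proof. by have [m ->] := power_measure_pack n. Qed.

Let pm_sigma_additive : semi_sigma_additive (@power_measure n).
Proof.
by have [m ->] := power_measure_pack n; exact: measure_semi_sigma_additive.
Qed.

HB.instance Definition _ := isMeasure.Build _ _ _ (@power_measure n)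
  pm0 pm_ge0 pm_sigma_additive.

Let pm_sigma_finite : sigma_finite setT (@power_measure n).
Proof. by have [m ->] := power_measure_pack n; exact: sigma_finiteT. Qed.

HB.instance Definition _ := Measure_isSigmaFinite.Build _ _ _ (@power_measure n)
  pm_sigma_finite.

End power_measure.

Lemma power_measure_box d (T : measurableType d) (R : realType)
    (mu : {sigma_finite_measure set T -> \bar R}) n (A : set T) :
  measurable A ->
  (power_measure mu [set t : n.-tuple T | forall i, A (tnth t i)] =
   \prod_(i < n) mu A)%E.
Proof.
move=> mA; elim: n => [|n IH].
  rewrite big_ord0 /= diracE mem_set // => i; by case: i.
rewrite big_ord_recl /= -IH.
have -> : (mu A = \int[mu]_x (\1_A x)%:E)%E by rewrite integral_indic // setIT.
rewrite -ge0_integralZr //; last exact/measurable_EFinP/measurable_indic.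
apply: eq_integral => x _; rewrite indicE.
have [xA|xA] := boolP (x \in A).
  rewrite mul1e; congr (power_measure _ _); apply/seteqP; split => t /=.
    by move=> h i; have := h (lift ord0 i); rewrite tnthS.
  move=> h i; case: (unliftP ord0 i) => [j ->|->]; first by rewrite tnthS.
  by rewrite tnth0; exact/set_mem.
rewrite mul0e -[RHS](measure0 (power_measure mu (n:=n))).
congr (power_measure _ _); apply/seteqP; split => t //= h.
by have := h ord0; rewrite tnth0 => /mem_set; rewrite (negbTE xA).
Qed.

Section sphere.
Context (R : realType).

(* Squared Euclidean norm. *)
Definition sqnorm m (x : m.-tuple R) : R := \sum_(i < m) tnth x i ^+ 2.

Definition sphere n : Type := {x : n.+1.-tuple R | sqnorm x == 1}.

Definition sphere_val n : sphere n -> n.+1.-tuple R := val.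

Let e0 n : n.+1.-tuple R := [tuple (i == ord0)%:R | i < n.+1].

Let e0_sphere n : sqnorm (e0 n) == 1.
Proof.
rewrite /sqnorm (bigD1 ord0) //= tnth_mktuple eqxx expr1n big1 ?addr0 //.
by move=> i /negbTE i0; rewrite tnth_mktuple i0 expr0n.
Qed.

HB.instance Definition _ n := Choice.on (sphere n).
HB.instance Definition _ n := isPointed.Build (sphere n) 
  (exist (fun x : n.+1.-tuple R => sqnorm x == 1) (e0 n) (e0_sphere n)).
(* The trace of the Borel sigma-algebra of R^(n+1), i.e. the Borel
   sigma-algebra of the sphere. *)
HB.instance Definition _ n := Measurable.copy (sphere n)
  (g_sigma_algebra_preimageType (@sphere_val n)).

(* The points r s with s in A and 0 < r <= 1. *)
Definition cone n (A : set (sphere n)) : set (n.+1.-tuple R) :=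
  [set x | exists2 s, A s & exists2 r, 0 < r <= 1 &
    x = [tuple r * tnth (sphere_val s) i | i < n.+1]].

(* In polar coordinates a cone over A has volume
   \int_0^1 r^n dr * sigma(A) = sigma(A) / (n + 1); as usual this identity is
   taken as the definition of the surface measure sigma on the sphere. *)
Definition surface_measure n (A : set (sphere n)) : \bar R :=
  (n.+1%:R%:E * power_measure lebesgue_measure (cone A))%E.


Variable n : nat.

Let ray (x : n.+1.-tuple R) : n.+1.-tuple R :=
  [tuple tnth x i * sqnorm x `^ (- 2^-1) | i < n.+1].

Let measurable_sqnorm : measurable_fun setT (@sqnorm n.+1).
Proof.
apply: measurable_sum => i; apply: measurable_funX; exact: measurable_tnth.
Qed.

Let measurable_ray : measurable_fun setT ray.
Proof.
apply/measurable_fun_tnthP => i.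
rewrite (_ : _ \o _ = fun x => tnth x i * sqnorm x `^ (- 2^-1)); last first.
  by apply/funext => x /=; rewrite tnth_mktuple.
apply: measurable_funM; first exact: measurable_tnth.
exact: (measurableT_comp (measurable_powR _)).
Qed.

Let sqnorm_scale (r : R) (x : n.+1.-tuple R) :
  sqnorm [tuple r * tnth x i | i < n.+1] = r ^+ 2 * sqnorm x.
Proof.
rewrite /sqnorm mulr_sumr; apply: eq_bigr => i _.
by rewrite tnth_mktuple exprMn.
Qed.

Let ray_scale (r : R) (s : sphere n) : 0 < r ->
  ray [tuple r * tnth (sphere_val s) i | i < n.+1] = sphere_val s.
Proof.
move=> r0; apply/eq_from_tnth => i.
rewrite /ray !tnth_mktuple sqnorm_scale (eqP (valP s)) mulr1.
rewrite powRN powR12_sqrt ?sqr_ge0 // sqrtr_sqr gtr0_norm //.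
by rewrite mulrAC divff ?mul1r // gt_eqF.
Qed.

Let measurable_cone (A : set (sphere n)) : measurable A -> measurable (cone A).
Proof.
move=> [B mB]; rewrite setTI => <-.
rewrite (_ : cone _ = ray @^-1` B `&` (@sqnorm n.+1) @^-1` `]0, 1]).
  apply: measurableI; rewrite -[X in measurable X]setTI.
    exact: measurable_ray.
  exact: measurable_sqnorm.
apply/seteqP; split => [x [s Bs [r /andP[r0 r1] ->]]|x [Bx]] /=.
  rewrite ray_scale //; split => //.
  rewrite in_itv /= sqnorm_scale (eqP (valP s)) mulr1 exprn_gt0 //=.
  by rewrite expr_le1 // ltW.
rewrite in_itv /= => /andP[x0 x1].
have rx : sqnorm (ray x) == 1.
  rewrite (_ : ray x = [tuple sqnorm x `^ (- 2^-1) * tnth x i | i < n.+1]).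
    rewrite sqnorm_scale powRN powR12_sqrt ?ltW // exprVn sqr_sqrtr ?ltW //.
    by rewrite mulVf // gt_eqF.
  by apply/eq_from_tnth => i; rewrite !tnth_mktuple mulrC.
exists (exist (fun x : n.+1.-tuple R => sqnorm x == 1) _ rx) => //.
exists (Num.sqrt (sqnorm x)).
  by rewrite sqrtr_gt0 x0 -sqrtr1 ler_sqrt.
apply/eq_from_tnth => i; rewrite !tnth_mktuple powRN powR12_sqrt ?ltW //.
by rewrite mulrCA divff ?mulr1 // gt_eqF // sqrtr_gt0.
Qed.

Let cone_set0 : cone (set0 : set (sphere n)) = set0.
Proof. by apply/seteqP; split => // x []. Qed.

Let sm0 : surface_measure (set0 : set (sphere n)) = 0%E.
Proof. by rewrite /surface_measure cone_set0 measure0 mule0. Qed.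

Let sm_ge0 (A : set (sphere n)) : (0 <= surface_measure A)%E.
Proof. by rewrite /surface_measure mule_ge0 // lee_fin. Qed.

Let sm_sigma_additive : semi_sigma_additive (@surface_measure n).
Proof.
move=> F mF tF mUF; rewrite /surface_measure.
rewrite [X in X @ \oo --> _](_ : _ = (fun k => n.+1%:R%:E *
    \sum_(0 <= i < k) power_measure lebesgue_measure (cone (F i)))%E); last first.
  by apply/funext => k; rewrite ge0_sume_distrr.
apply: cvgeZl => //.
rewrite (_ : cone _ = \bigcup_i cone (F i)); last first.
  apply/seteqP; split => [x [s [i _ Fis] hr]|x [i _ [s Fis hr]]].
    by exists i => //; exists s.
  by exists s => //; exists i.
apply: measure_semi_sigma_additive.
- by move=> i; exact: measurable_cone.
- apply/trivIsetP => i j _ _ ij; apply/seteqP; split => // x.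
  move=> [[s Fs [r /andP[r0 _] ->]] [s' Fs' [r' /andP[r0' _] E]]].
  have /val_inj ss' : sphere_val s = sphere_val s'.
    by rewrite -(ray_scale s r0) E ray_scale.
  move/trivIsetP : tF => /(_ i j I I ij) FF.
  suff : (set0 : set (sphere n)) s by [].
  by rewrite -FF; split => //; rewrite ss'.
- by apply: bigcupT_measurable => i; exact: measurable_cone.
Qed.

HB.instance Definition _ := isMeasure.Build _ _ _ (@surface_measure n)
  sm0 sm_ge0 sm_sigma_additive.

Let sm_fin : fin_num_fun (@surface_measure n).
Proof.
move=> A mA; rewrite /surface_measure fin_numM // ge0_fin_numE //.
have mI : measurable (`[-1, 1]%classic : set R) by exact: measurable_itv.
apply: (@le_lt_trans _ _ (power_measure lebesgue_measure
  [set t : n.+1.-tuple R | forall i, `[-1, 1]%classic (tnth t i)])).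
  apply: le_measure; rewrite ?inE.
  - exact: measurable_cone.
  - rewrite (_ : [set _ | _] =
        \bigcap_(i in [set: 'I_n.+1]) ((fun t => tnth t i) @^-1` `[-1, 1])).
      apply: fin_bigcap_measurable => // i _; rewrite -[X in measurable X]setTI.
      exact: measurable_tnth.
    by apply/seteqP; split => t /= h i; [move=> _|]; exact: (h i).
  move=> _ [s _ [r /andP[r0 r1] ->]] i /=; rewrite tnth_mktuple in_itv /= -ler_norml.
  rewrite normrM (gtr0_norm r0) mulr_ile1 ?normr_ge0 ?(ltW r0) //.
  rewrite -(@ler_pXn2r _ 2) ?nnegrE // expr1n -[_ ^+ 2]real_normK ?num_real //.
  by rewrite -(eqP (valP s)) /sqnorm (bigD1 i) //= normr_id real_normK ?num_real // lerDl sumr_ge0 // => j _; exact: sqr_ge0.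
rewrite power_measure_box // (eq_bigr (fun=> (1 - -1 : R)%:E)); last first.
  move=> i _; rewrite [LHS]lebesgue_measure_itv /= lte_fin.
  by rewrite (lt_trans (ltrN10 R)) // -EFinD.
by rewrite prodEFin ltry.
Qed.

HB.instance Definition _ := Measure_isFinite.Build _ _ _ (@surface_measure n)
  sm_fin.

End sphere.

Section determinant_inequality.
Context (R : realType) (n : nat).
Local Open Scope ereal_scope.

Definition absdet (s : n.+1.-tuple (sphere R n)) : R :=
  `|\det (\matrix_(i < n.+1, j < n.+1) tnth (sphere_val (tnth s j)) i)|%R.

Definition det_sup (p : R) (F : 'I_n.+1 -> sphere R n -> R) : \bar R :=
  ess_sup (power_measure (@surface_measure R n) (n:=n.+1))
    (fun s => ((\prod_(j < n.+1) F j (tnth s j)) *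
               absdet s `^ (n.+1%:R / p))%R%:E).

Definition prod_Lnorm (p : R) (F : 'I_n.+1 -> sphere R n -> R) : \bar R :=
  \prod_(j < n.+1) 'N[@surface_measure R n]_p%:E[EFin \o F j].

Definition det_inequality (p B : R) : Prop :=
  forall F : 'I_n.+1 -> {mfun sphere R n >-> R},
    (forall j s, (0 <= F j s)%R) ->
    (forall j, finite_norm (@surface_measure R n) p%:E (F j)) ->
    prod_Lnorm p F <= B%:E * det_sup p F.

End determinant_inequality.

(* Main.v *)
Require Import Defs.
From mathcomp Require Import all_boot all_order all_algebra.
From mathcomp Require Import all_classical all_reals all_analysis.
From mathcomp Require Import measurable_realfun ess_sup_inf.
From mathcomp Require Import ring lra.

(** Put N = n + 1.  After raising to the power p, the inequality is a statement
    about the star-shaped sets K_j = { r s : 0 < r, r^N <= F_j(s)^p } of R^N: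
    the integral of F_j^p is N |K_j|, and the supremum on the right bounds
    |det(x_1, ..., x_N)| for x_j in K_j by some D.  What has to be shown is that
    such sets satisfy |K_1| ... |K_N| <= omega^N D^N, where omega is the volume of
    the unit ball; that is, the product of the radii of the balls of volumes
    |K_j| is at most D ([det_prod_volumes]).  Balls give equality by Hadamard's
    inequality ([hadamard]), which is where constant functions come from.

    The proof is by Steiner symmetrization, applied to all the K_j in the same
    direction u.  Write x_j = y_j + a_j u with y_j orthogonal to u.  The
    determinant is then linear in (a_1, ..., a_N) ([row_det_rank1]), so its value
    at the symmetrized points is at most half the difference of two values taken
    on the original fibres; hence the bound D survives
    ([steiner_det]).  Volumes do not decrease, by Fubini along u
    ([vol_steiner]).

    Convergence to balls needs no compactness argument.  Let K be open and
    convex, contain the unit ball, and contain a point at distance at least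
    t > 1 from the origin.  By convexity K also contains a neighbourhood, of
    size depending on t only, of a point e of the unit sphere.  Symmetrizing in
    a direction close to p - e creates a similar neighbourhood of p while
    keeping the earlier ones ([local_gain_spread]); a finite net of points p
    then yields a ball of radius 1 + eps, with eps depending on t only
    ([ball_grows]).  As long as the ball inside K has smaller volume than K such
    a far point exists, so the radius grows geometrically and every radius below
    the volume radius of K is reached ([ball_reaches]), for all the K_j with one
    common sequence of directions.  Evaluating the determinant on the vectors
    s_j e_j then gives s_1 ... s_N <= D ([det_prod_radii]).

    The sets can be taken open and convex: a convex symmetric hull does not
    change the bound because the determinant is affine in each row
    ([symhull_det]), and thickening changes it little ([row_det_perturb]).  The
    essential supremum is dealt with by keeping only the pieces of the sphere on
    which a simple function below F_j^p is constant, which are small, and which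
    have positive measure: a product of such pieces always contains a tuple at
    which the almost everywhere bound holds ([thick_det]). *)

Set Implicit Arguments.
Unset Strict Implicit.
Unset Printing Implicit Defensive.

Import Order.TTheory GRing.Theory Num.Theory.
Import numFieldNormedType.Exports.

Local Open Scope classical_set_scope.
Local Open Scope ring_scope.

(** * Euclidean norm on row vectors *)

Section Euclidean.
Context {R : realType} {n : nat}.
Implicit Types (x y z : 'rV[R]_n) (a r : R).

Definition dot x y : R := \sum_i x 0 i * y 0 i.

Lemma dotC x y : dot x y = dot y x.
Proof. by apply: eq_bigr => i _; rewrite mulrC. Qed.

Lemma dotDl x y z : dot (x + y) z = dot x z + dot y z.
Proof. by rewrite -big_split; apply: eq_bigr => i _; rewrite !mxE mulrDl. Qed.

Lemma dotZl a x y : dot (a *: x) y = a * dot x y.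
Proof. by rewrite mulr_sumr; apply: eq_bigr => i _; rewrite !mxE mulrA. Qed.

Lemma dotNl x y : dot (- x) y = - dot x y.
Proof. by rewrite -scaleN1r dotZl mulN1r. Qed.

Lemma dotDr x y z : dot x (y + z) = dot x y + dot x z.
Proof. by rewrite dotC dotDl !(dotC x). Qed.

Lemma dotZr a x y : dot x (a *: y) = a * dot x y.
Proof. by rewrite dotC dotZl dotC. Qed.

Lemma dotNr x y : dot x (- y) = - dot x y.
Proof. by rewrite dotC dotNl dotC. Qed.

Definition dotE := (dotDl, dotDr, dotNl, dotNr, dotZl, dotZr).

Lemma dot_ge0 x : 0 <= dot x x.
Proof. by apply: sumr_ge0 => i _; rewrite -expr2 sqr_ge0. Qed.

Lemma dot_eq0 x : dot x x = 0 -> x = 0.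
Proof.
move/eqP; rewrite psumr_eq0; last by move=> i _; rewrite -expr2 sqr_ge0.
move=> /allP h; apply/rowP => i; apply/eqP.
by have := h i (mem_index_enum _); rewrite mulf_eq0 orbb mxE.
Qed.

Definition nrm x : R := Num.sqrt (dot x x).

Lemma nrm_ge0 x : 0 <= nrm x. Proof. exact: sqrtr_ge0. Qed.

Lemma sqr_nrm x : nrm x ^+ 2 = dot x x.
Proof. by rewrite sqr_sqrtr // dot_ge0. Qed.

Lemma nrm_gt0 x : x != 0 -> 0 < nrm x.
Proof.
move=> x0; rewrite sqrtr_gt0 lt_neqAle dot_ge0 andbT eq_sym.
by apply: contra x0 => /eqP/dot_eq0 ->.
Qed.

Lemma nrm0 : nrm 0 = 0.
Proof. by rewrite /nrm -(scale0r 0) dotZl mul0r sqrtr0. Qed.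

Lemma nrm_lt x r : 0 <= r -> (nrm x < r) = (dot x x < r ^+ 2).
Proof.
by move=> r0; rewrite -sqr_nrm ltr_pXn2r // nnegrE ?nrm_ge0.
Qed.

Lemma nrm_le x r : 0 <= r -> (nrm x <= r) = (dot x x <= r ^+ 2).
Proof.
by move=> r0; rewrite -sqr_nrm ler_pXn2r // nnegrE ?nrm_ge0.
Qed.

Lemma nrmZ a x : nrm (a *: x) = `|a| * nrm x.
Proof. by rewrite /nrm !dotE mulrA -expr2 sqrtrM ?sqr_ge0 // sqrtr_sqr. Qed.

Lemma nrmN x : nrm (- x) = nrm x.
Proof. by rewrite /nrm !dotE opprK. Qed.

Lemma nrmB x y : nrm (x - y) = nrm (y - x).
Proof. by rewrite -nrmN opprB. Qed.

Lemma cauchy_schwarz x y : `|dot x y| <= nrm x * nrm y.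
Proof.
rewrite -ler_sqr ?nnegrE ?mulr_ge0 ?nrm_ge0 //.
rewrite real_normK ?num_real // exprMn !sqr_nrm.
have [y0|y0] := eqVneq (dot y y) 0.
  have -> := dot_eq0 y0.
  by rewrite -(scale0r 0) dotZr mul0r expr0n /= mulr_ge0 ?dot_ge0.
have yp : 0 < dot y y by rewrite lt_neqAle eq_sym y0 dot_ge0.
have := dot_ge0 (dot y y *: x - dot x y *: y).
rewrite !dotE (dotC y x) => h.
rewrite -subr_ge0 -(pmulr_rge0 _ yp).
by apply: le_trans h _; rewrite le_eqVlt; apply/orP; left; apply/eqP; ring.
Qed.

Lemma nrmD x y : nrm (x + y) <= nrm x + nrm y.
Proof.
rewrite nrm_le ?addr_ge0 ?nrm_ge0 // sqrrD !sqr_nrm !dotE (dotC y x).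
have := le_trans (ler_norm _) (cauchy_schwarz x y); lra.
Qed.

Lemma coord_le_nrm x i : `|x 0 i| <= nrm x.
Proof.
rewrite -ler_sqr ?nnegrE ?nrm_ge0 // sqr_nrm real_normK ?num_real //.
by rewrite /dot (bigD1 i) //= expr2 lerDl sumr_ge0 // => j _; rewrite -expr2 sqr_ge0.
Qed.

Lemma nrm_le_coord x r : 0 <= r -> (forall i, `|x 0 i| <= r) -> nrm x <= n%:R * r.
Proof.
move=> r0 h; rewrite nrm_le ?mulr_ge0 //.
apply: (@le_trans _ _ (\sum_(i < n) r ^+ 2)).
  apply: ler_sum => i _; rewrite -expr2 -[x 0 i ^+ 2]real_normK ?num_real //.
  by rewrite ler_sqr ?nnegrE.
rewrite sumr_const card_ord -[leLHS]mulr_natl exprMn ler_wpM2r ?sqr_ge0 //.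
by rewrite -natrX ler_nat; case: (n) => // m; rewrite leq_pmulr.
Qed.

Lemma dot_delta x i : dot x (delta_mx 0 i) = x 0 i.
Proof.
rewrite /dot (bigD1 i) //= mxE !eqxx mulr1 big1 ?addr0 // => j ji.
by rewrite mxE eqxx (negbTE ji) mulr0.
Qed.

Lemma nrm_delta i : nrm (delta_mx 0 i) = 1.
Proof. by rewrite /nrm dot_delta mxE !eqxx sqrtr1. Qed.

End Euclidean.

(** * The determinant as a function of its rows *)

Section Determinant.
Context {R : realType} {n : nat}.
Implicit Types (x y : 'I_n -> 'rV[R]_n) (z c : 'rV[R]_n).

Definition row_det x : R := \det (\matrix_i x i).

Definition update (T : Type) (x : 'I_n -> T) (j : 'I_n) (z : T) : 'I_n -> T :=
  fun k => if k == j then z else x k.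

Lemma update_same (T : Type) (x : 'I_n -> T) j : update x j (x j) = x.
Proof. by apply/funext => k; rewrite /update; case: eqP => // ->. Qed.

(** Row j enters the determinant linearly; the vector c is the vector of its
    cofactors, orthogonal to the other rows by [row_det_repeated]. *)
Lemma row_det_update x j : exists c, forall z, row_det (update x j z) = dot z c.
Proof.
exists (\row_k cofactor (\matrix_i x i) j k) => z.
rewrite /row_det (expand_det_row _ j); apply: eq_bigr => k _.
rewrite !mxE /update eqxx; congr (_ * _).
rewrite /cofactor; congr (_ * \det _); apply/matrixP => a b.
by rewrite !mxE eq_sym (negbTE (neq_lift _ _)).
Qed.

Lemma row_det_repeated x j k : j != k -> row_det (update x j (x k)) = 0.
Proof.
move=> jk; apply: (determinant_alternate jk) => i.
by rewrite !mxE /update eqxx eq_sym (negbTE jk).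
Qed.

(** T is the set of rows not yet normalized.  With c the cofactor vector of a
    row x_k in T, the determinant is at most |x_k| |c|, and |c| is the
    determinant obtained by replacing x_k by c / |c|, a unit vector orthogonal
    to all other rows.  Once every row has been replaced the matrix is
    orthogonal. *)
Lemma hadamard_rec (T : {set 'I_n}) x :
  (forall j, j \notin T -> forall i, dot (x j) (x i) = (i == j)%:R) ->
  `|row_det x| <= \prod_(j in T) nrm (x j).
Proof.
move: {2}(#|T|) (erefl #|T|) => m; elim: m T x => [|m IH] T x mT h.
  move/cards0_eq : mT => T0; subst T; rewrite big_set0 /row_det.
  set A := (\matrix_i x i).
  have AA : A *m A^T = 1%:M.
    apply/matrixP => i j; rewrite !mxE.
    under eq_bigr do rewrite !mxE.
    by have := h i; rewrite inE => /(_ isT j); rewrite /dot eq_sym => ->.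
  have : \det A ^+ 2 = 1 by rewrite expr2 -{2}det_tr -det_mulmx AA det1.
  move=> d2; rewrite -(@ler_pXn2r _ 2) ?nnegrE //.
  by rewrite real_normK ?num_real // d2 expr1n.
have /card_gt0P[k kT] : (0 < #|T|)%N by rewrite mT.
have [c hc] := row_det_update x k.
rewrite (big_setD1 k) //=.
have -> : row_det x = dot (x k) c by rewrite -hc update_same.
apply: le_trans (cauchy_schwarz _ _) _.
apply: ler_wpM2l; first exact: nrm_ge0.
have [->|c0] := eqVneq c 0.
  by rewrite nrm0 prodr_ge0 // => j _; rewrite nrm_ge0.
have c1 := nrm_gt0 c0.
set x' := update x k ((nrm c)^-1 *: c).
have -> : nrm c = `|row_det x'|.
  by rewrite hc dotZl -sqr_nrm expr2 mulKf ?gt_eqF // ger0_norm // nrm_ge0.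
have -> : \prod_(i in T :\ k) nrm (x i) = \prod_(i in T :\ k) nrm (x' i).
  by apply: eq_bigr => i; rewrite !inE /x' /update => /andP[/negbTE ->].
apply: IH => [|j].
  by move: mT; rewrite (cardsD1 k) kT => -[].
have co i : i != k -> dot c (x i) = 0.
  by move=> ik; rewrite dotC -hc row_det_repeated // eq_sym.
have cc : dot ((nrm c)^-1 *: c) ((nrm c)^-1 *: c) = 1.
  by rewrite !dotE mulrA -expr2 -sqr_nrm -exprMn mulVf ?expr1n // gt_eqF.
rewrite !inE negb_and negbK => /orP[/eqP ->|jT] i; rewrite /x' /update.
  by rewrite eqxx; have [_|ik] := eqVneq i k; rewrite ?cc // dotZl co ?mulr0.
have jk : j != k by apply: contraNneq jT => ->.
rewrite (negbTE jk); have [->|ik] := eqVneq i k.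
  by rewrite eq_sym (negbTE jk) dotC dotZl co ?mulr0.
exact: h.
Qed.

Lemma hadamard x : `|row_det x| <= \prod_j nrm (x j).
Proof.
have := @hadamard_rec [set: 'I_n] x; under eq_bigl do rewrite inE.
by apply => j; rewrite inE.
Qed.

Lemma row_det_diff x j z z' :
  row_det (update x j z) - row_det (update x j z') = row_det (update x j (z - z')).
Proof. by have [c hc] := row_det_update x j; rewrite !hc !dotE. Qed.

(** Rows are exchanged one at a time; by Hadamard's inequality each exchange
    costs at most e M^(n-1), which is at most e M^n as M >= 1. *)
Lemma row_det_perturb x y (e M : R) : 1 <= M ->
  (forall j, nrm (x j) <= M) -> (forall j, nrm (y j) <= M) ->
  (forall j, nrm (x j - y j) <= e) ->
  `|row_det x| <= `|row_det y| + n%:R * (e * M ^+ n).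
Proof.
move=> M1 xM yM xy.
pose w (s : seq 'I_n) j := if j \in s then x j else y j.
have M0 : 0 <= M := le_trans ler01 M1.
have e0 : forall j : 'I_n, 0 <= e by move=> j; apply: le_trans (nrm_ge0 _) (xy j).
suff H s : `|row_det (w s)| <= `|row_det y| + (size s)%:R * (e * M ^+ n).
  have := H (enum 'I_n); rewrite size_enum_ord.
  by have -> : w (enum 'I_n) = x by apply/funext => j; rewrite /w mem_enum.
elim: s => [|k s IH]; first by rewrite /= mul0r addr0.
have wk : w (k :: s) = update (w s) k (x k).
  by apply/funext => j; rewrite /w /update inE; case: eqP => // ->.
have ws : `|row_det (w (k :: s))| <= `|row_det (w s)| + e * M ^+ n.
  have [ks|ks] := boolP (k \in s).
    have -> : w (k :: s) = w s.
      by apply/funext => j; rewrite /w inE; case: eqP => // ->; rewrite ks.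
    by rewrite lerDl mulr_ge0 ?exprn_ge0 // (e0 k).
  have wsE : w s = update (w s) k (y k).
    by apply/funext => j; rewrite /w /update; case: eqP => // ->; rewrite (negbTE ks).
  rewrite wk {2}wsE -lerBlDl.
  apply: le_trans (lerB_dist _ _) _.
  rewrite row_det_diff; apply: le_trans (hadamard _) _.
  rewrite (bigD1 k) //= /update eqxx; apply: ler_pM => //.
  - exact: nrm_ge0.
  - by apply: prodr_ge0 => j _; exact: nrm_ge0.
  apply: (@le_trans _ _ (\prod_(i < n | i != k) M)).
    apply: ler_prod => j jk; rewrite nrm_ge0 /= (negbTE jk) /w.
    by case: (j \in s); [exact: xM|exact: yM].
  have -> : M ^+ n = \prod_(i < n) M by rewrite prodr_const card_ord.
  rewrite [leRHS](bigD1 k) //= ler_peMl //.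
  by apply: prodr_ge0.
apply: le_trans ws _.
by rewrite /= -addn1 natrD mulrDl mul1r addrA lerD2r.
Qed.

End Determinant.

Section RankOne.
Context {R : realType} {n : nat}.

(** The matrix with rows y_j + a_j u factors as W(a) T, where W(a) has first
    column a and keeps the other columns of the y_j, and T does not depend
    on a: the first coordinate of y_j is determined by the others because y_j is
    orthogonal to u and u has nonzero first coordinate.  Expanding W(a) along its
    first column gives the linear form. *)
Lemma row_det_rank1 (u : 'rV[R]_n.+1) (y : 'I_n.+1 -> 'rV[R]_n.+1) :
  u 0 0 != 0 -> (forall j, dot (y j) u = 0) ->
  exists c : 'I_n.+1 -> R, forall a : 'I_n.+1 -> R,
    row_det (fun j => y j + a j *: u) = \sum_j a j * c j.
Proof.
move=> u0 yu.
pose W (a : 'I_n.+1 -> R) : 'M[R]_n.+1 :=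
  \matrix_(i, k) (if k == 0 then a i else y i 0 k).
pose T : 'M[R]_n.+1 := \matrix_(i, k)
  (if i == 0 then u 0 k else if k == 0 then - u 0 i / u 0 0 else (i == k)%:R).
exists (fun j => cofactor (W (fun=> 0)) j 0 * \det T) => a.
have -> : row_det (fun j => y j + a j *: u) = \det (W a) * \det T.
  rewrite -det_mulmx /row_det; congr (\det _); apply/matrixP => i k; rewrite !mxE.
  rewrite (bigD1 0) //= !mxE eqxx [RHS]addrC; congr (_ + _).
  under eq_bigr => l l0 do rewrite !mxE (negbTE l0).
  have [->|k0] := eqVneq k 0.
    have /eqP := yu i; rewrite /dot (bigD1 0) //= addr_eq0 => /eqP yi.
    apply: (mulIf u0); rewrite yi mulr_suml -sumrN; apply: eq_bigr => l _.
    by rewrite mulNr mulrN mulNr -!mulrA mulVf // mulr1.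
  rewrite (bigD1 k) //= eqxx mulr1 big1 ?addr0 // => l /andP[_ /negbTE ->].
  by rewrite mulr0.
rewrite (expand_det_col _ 0) mulr_suml; apply: eq_bigr => i _.
rewrite !mxE eqxx -mulrA; congr (_ * (_ * _)).
rewrite /cofactor; congr (_ * \det _); apply/matrixP => b k; rewrite !mxE.
by rewrite eq_sym (negbTE (neq_lift _ _)).
Qed.

End RankOne.

(** * Open convex sets and symmetric hulls *)

Section Convex.
Context {R : realType} {n : nat}.
Implicit Types (K U C : set 'rV[R]_n) (x y z u : 'rV[R]_n).

(** Openness is stated with the Euclidean norm [nrm], while the norm that row
    vectors carry as a normed module is the sup norm. *)
Definition euclid_open K := forall x, K x ->
  exists2 e : R, 0 < e & forall y, nrm (y - x) < e -> K y.

Definition euclid_convex K := forall x y (t : R), K x -> K y -> 0 <= t <= 1 ->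
  K (t *: x + (1 - t) *: y).

Definition open_ball (r : R) : set 'rV[R]_n := [set x | nrm x < r].

Definition hull U : set 'rV[R]_n :=
  [set x | forall C, euclid_convex C -> U `<=` C -> C x].

Lemma sub_hull U : U `<=` hull U.
Proof. by move=> x Ux C _; apply. Qed.

Lemma hull_convex U : euclid_convex (hull U).
Proof. by move=> x y t hx hy t01 C cC UC; exact: cC (hx C cC UC) (hy C cC UC) t01. Qed.

(** The interior of the hull of an open set U is convex and contains U. *)
Lemma hull_open U : euclid_open U -> euclid_open (hull U).
Proof.
move=> oU x /(_ [set x | exists2 e : R, 0 < e &
  forall y, nrm (y - x) < e -> hull U y]); apply.
  move=> {}x y t [e e0 he] [d d0 hd] /andP[t0 t1].
  exists (Num.min e d); first by rewrite lt_min e0.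
  move=> z; rewrite lt_min => /andP[ze zd].
  pose w := z - (t *: x + (1 - t) *: y).
  have -> : z = t *: (x + w) + (1 - t) *: (y + w).
    by apply/rowP => i; rewrite /w !mxE; ring.
  apply: hull_convex; rewrite ?t0 //.
    by apply: he; rewrite addrC addKr.
  by apply: hd; rewrite addrC addKr.
by move=> {}x /oU[e e0 he]; exists e => // y /he; exact: sub_hull.
Qed.

Definition symhull U := hull (U `|` [set x | U (- x)]).

Lemma symhull_open U : euclid_open U -> euclid_open (symhull U).
Proof.
move=> oU; apply: hull_open => x [/oU[e e0 he]|/oU[e e0 he]]; exists e => // y ye.
  by left; exact: he.
by right; apply: he; rewrite -opprD nrmN.
Qed.

(** A point w near 0 is the midpoint of x + w and -(x - w), both of which lie
    in the symmetrized set when x is an interior point of U. *)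
Lemma symhull_ball U : euclid_open U -> U !=set0 ->
  exists2 s, 0 < s & open_ball s `<=` symhull U.
Proof.
move=> oU [x /oU[e e0 he]]; exists e => // w we.
have -> : w = 2^-1 *: (x + w) + (1 - 2^-1) *: (- (x - w)).
  by apply/rowP => i; rewrite !mxE; field.
apply: hull_convex.
- by apply: sub_hull; left; apply: he; rewrite addrC addKr.
- apply: sub_hull; right; rewrite /= opprK; apply: he.
  by rewrite addrC addKr nrmN.
- by apply/andP; split; lra.
Qed.

End Convex.

Section HullDet.
Context {R : realType} {n : nat}.
Implicit Types (K U : 'I_n -> set 'rV[R]_n).

Definition det_bounded K (D : R) := forall x : 'I_n -> 'rV[R]_n,
  (forall j, K j (x j)) -> `|row_det x| <= D.

(** One index at a time: the vectors z that keep the determinant bounded by D in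
    row k form a convex symmetric set. *)
Lemma symhull_det U D : det_bounded U D -> det_bounded (fun j => symhull (U j)) D.
Proof.
move=> UD.
suff H (s : seq 'I_n) : det_bounded (fun j => if j \in s then symhull (U j) else U j) D.
  by move=> x hx; apply: (H (enum 'I_n)) => j; rewrite mem_enum; exact: hx.
elim: s => // k s IH x hx.
have [ks|ks] := boolP (k \in s).
  apply: IH => j; have := hx j; rewrite inE.
  by case: eqP => // ->; rewrite ks.
have xk : symhull (U k) (x k) by have := hx k; rewrite inE eqxx.
have [c hc] := row_det_update x k.
rewrite -(update_same x k); apply: (xk [set z | `|row_det (update x k z)| <= D]).
  move=> y z t /=; rewrite !hc !dotE => h1 h2 /andP[t0]; rewrite -subr_ge0 => t1.
  apply: le_trans (ler_normD _ _) _; rewrite !normrM (ger0_norm t0) (ger0_norm t1).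
  have -> : D = t * D + (1 - t) * D by ring.
  by apply: lerD; apply: ler_wpM2l.
have hU z : U k z -> `|row_det (update x k z)| <= D.
  move=> Uz; apply: IH => j; rewrite /update; have := hx j; rewrite inE.
  by case: eqP => // ->; rewrite (negbTE ks).
move=> z [/hU //|/hU] /=; by rewrite !hc dotNl normrN.
Qed.

End HullDet.

(** * Steiner symmetrization *)

Section Steiner.
Context {R : realType} {n : nat}.
Implicit Types (K U C : set 'rV[R]_n) (x y z u : 'rV[R]_n).

(** The fibre of K in the direction u through x is replaced by the centred open
    interval of length the diameter of that fibre (u being a unit vector).  For
    convex K this is Steiner symmetrization; the description by two points of
    the fibre makes openness and convexity immediate and avoids measuring
    fibres. *)
Definition steiner u K : set 'rV[R]_n :=
  [set x | exists a b : R,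
     [/\ K (x + a *: u), K (x + b *: u) & 2 * `|dot x u| < b - a]].

Lemma steiner_open u K : nrm u = 1 -> euclid_open K -> euclid_open (steiner u K).
Proof.
move=> u1 oK x [a [b [/oK[e e0 he] /oK[d d0 hd] xu]]].
exists (Num.min (Num.min e d) ((b - a - 2 * `|dot x u|) / 2)).
  by rewrite !lt_min e0 d0 divr_gt0 ?subr_gt0.
move=> y; rewrite !lt_min => /andP[/andP[ye yd] yg].
exists a, b; split.
- by apply: he; rewrite [x + _]addrC addrKA.
- by apply: hd; rewrite [x + _]addrC addrKA.
have -> : dot y u = dot x u + dot (y - x) u by rewrite !dotE; ring.
have := ler_normD (dot x u) (dot (y - x) u).
have := cauchy_schwarz (y - x) u; rewrite u1 mulr1.
lra.
Qed.

Lemma steiner_convex u K : euclid_convex K -> euclid_convex (steiner u K).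
Proof.
move=> cK x y t [a [b [xa xb xu]]] [c [d [yc yd yu]]] /andP[t0 t1].
exists (t * a + (1 - t) * c), (t * b + (1 - t) * d); split.
- have -> : t *: x + (1 - t) *: y + (t * a + (1 - t) * c) *: u =
    t *: (x + a *: u) + (1 - t) *: (y + c *: u).
    by apply/rowP => i; rewrite !mxE; ring.
  by apply: cK; rewrite ?t0.
- have -> : t *: x + (1 - t) *: y + (t * b + (1 - t) * d) *: u =
    t *: (x + b *: u) + (1 - t) *: (y + d *: u).
    by apply/rowP => i; rewrite !mxE; ring.
  by apply: cK; rewrite ?t0.
rewrite !dotE.
have := ler_normD (t * dot x u) ((1 - t) * dot y u).
have t1' : 0 <= 1 - t by rewrite subr_ge0.
rewrite !normrM (ger0_norm t0) (ger0_norm t1') => h.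
have [t1E|tn] := eqVneq t 1; first by move: h; rewrite t1E; lra.
have : 0 < (1 - t) * (d - c - 2 * `|dot y u|).
  by rewrite mulr_gt0 ?subr_gt0 // lt_neqAle tn.
have : 0 <= t * (b - a - 2 * `|dot x u|) by rewrite mulr_ge0 // subr_ge0 ltW.
lra.
Qed.

Lemma dot_line u x (s : R) : nrm u = 1 ->
  dot (x + (s - dot x u) *: u) (x + (s - dot x u) *: u) =
  dot x x - dot x u ^+ 2 + s ^+ 2.
Proof.
by move=> u1; rewrite !dotE (dotC u x) -(sqr_nrm u) u1; ring.
Qed.

(** A ball is symmetric about the hyperplane orthogonal to u, and the point
    together with its mirror image can be pushed apart a little. *)
Lemma steiner_ball u K r : nrm u = 1 -> open_ball r `<=` K ->
  open_ball r `<=` steiner u K.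
Proof.
move=> u1 rK x xr; set c := dot x u.
have r0 : 0 < r := le_lt_trans (nrm_ge0 x) xr.
pose k := (r - nrm x) / 2.
have k0 : 0 < k by rewrite divr_gt0 // subr_gt0.
have cx : `|c| <= nrm x by have := cauchy_schwarz x u; rewrite u1 mulr1.
have H s : s ^+ 2 = (`|c| + k) ^+ 2 -> K (x + (s - c) *: u).
  move=> s2; apply: rK; rewrite /open_ball /= nrm_lt ?(ltW r0) // dot_line // s2.
  apply: (@le_lt_trans _ _ ((nrm x + k) ^+ 2)).
    rewrite -[dot x u ^+ 2]real_normK ?num_real // -/c -sqr_nrm.
    have := ler_wpM2l (ltW k0) cx; have := ltW k0; lra.
  rewrite ltr_pXn2r ?nnegrE ?addr_ge0 ?nrm_ge0 ?(ltW k0) ?(ltW r0) //.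
  rewrite /k; have : nrm x < r by []. lra.
exists (- (`|c| + k) - c), ((`|c| + k) - c); split.
- by apply: H; rewrite sqrrN.
- exact: H.
- by rewrite -/c; lra.
Qed.

End Steiner.

Section SteinerDet.
Context {R : realType} {n : nat}.

(** In each fibre take the two witnesses a_j < b_j of [steiner].  Choosing b_j
    where the coefficient c_j of the linear form is nonnegative and a_j elsewhere,
    and then the opposite choice, the two determinants are bounded by D, and
    their difference is at least twice the determinant at the symmetrized
    point. *)
Lemma steiner_det (u : 'rV[R]_n.+1) (K : 'I_n.+1 -> set 'rV[R]_n.+1) D :
  nrm u = 1 -> u 0 0 != 0 -> det_bounded K D -> det_bounded (fun j => steiner u (K j)) D.
Proof.
move=> u1 u0 KD x hx.
have [a ha] := choice hx; have [b hb] := choice ha.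
pose y j := x j - dot (x j) u *: u.
have yu j : dot (y j) u = 0.
  by rewrite /y !dotE -(sqr_nrm u) u1; ring.
have [c hc] := row_det_rank1 u0 yu.
pose w (s : 'I_n.+1 -> R) j := x j + s j *: u.
have E s : row_det (w s) = \sum_j (dot (x j) u + s j) * c j.
  rewrite -hc; congr row_det; apply/funext => j; rewrite /w /y.
  by apply/rowP => i; rewrite !mxE; ring.
have -> : x = w (fun=> 0).
  by apply/funext => j; rewrite /w scale0r addr0.
pose P j := if 0 <= c j then b j else a j.
pose Q j := if 0 <= c j then a j else b j.
have hP : `|row_det (w P)| <= D.
  by apply: KD => j; rewrite /w /P; have [h1 h2 _] := hb j; case: ifP.
have hQ : `|row_det (w Q)| <= D.
  by apply: KD => j; rewrite /w /Q; have [h1 h2 _] := hb j; case: ifP.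
have PQ : 2 * `|row_det (w (fun=> 0))| <= row_det (w P) - row_det (w Q).
  rewrite !E -sumrB.
  apply: (@le_trans _ _ (\sum_j 2 * (`|dot (x j) u| * `|c j|))).
    rewrite -mulr_sumr ler_pM2l //; apply: le_trans (ler_norm_sum _ _ _) _.
    by apply: ler_sum => j _; rewrite addr0 normrM.
  apply: ler_sum => j _; have [_ _ /ltW h] := hb j.
  rewrite -mulrBl mulrA /P /Q; case: ifPn => cj.
    rewrite (ger0_norm cj); have := ler_wpM2r cj h; lra.
  have cj' : 0 <= - c j by rewrite oppr_ge0 ltW // ltNge.
  rewrite -[`|c j|]normrN (ger0_norm cj'); have := ler_wpM2r cj' h; lra.
have := ler_norm (row_det (w P)); have := ler_norm (- row_det (w Q)); rewrite normrN.
lra.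
Qed.

(** The condition on the first coordinate says that lines of direction u are
    graphs over the first axis, which is what Fubini needs in [vol_steiner]. *)
Definition transverse (u : 'rV[R]_n.+1) := nrm u = 1 /\ u 0 0 != 0.

Definition symmetrize (us : seq 'rV[R]_n.+1) (K : set 'rV[R]_n.+1) := foldr steiner K us.

Definition all_transverse (us : seq 'rV[R]_n.+1) := forall u, u \in us -> transverse u.

Lemma all_transverse_cons u us : all_transverse (u :: us) <->
  transverse u /\ all_transverse us.
Proof.
split=> [h|[h1 h2] v]; first by split=> [|v vs]; apply: h; rewrite inE ?eqxx ?vs ?orbT.
by rewrite inE => /orP[/eqP ->|/h2].
Qed.

Lemma all_transverse_cat us vs : all_transverse us -> all_transverse vs ->
  all_transverse (us ++ vs).
Proof. by move=> h1 h2 u; rewrite mem_cat => /orP[/h1|/h2]. Qed.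

Lemma symmetrize_ind (P : set 'rV[R]_n.+1 -> Prop) us K :
  (forall u C, transverse u -> P C -> P (steiner u C)) ->
  all_transverse us -> P K -> P (symmetrize us K).
Proof.
move=> h; elim: us => //= u us IH /all_transverse_cons[u1 us1] PK.
by apply: h => //; exact: IH.
Qed.

Lemma symmetrize_det us K D : all_transverse us -> det_bounded K D ->
  det_bounded (fun j => symmetrize us (K j)) D.
Proof.
elim: us => //= u us IH /all_transverse_cons[[u1 u0] us1] KD.
by apply: (@steiner_det u (fun j => symmetrize us (K j))) => //; exact: IH.
Qed.

End SteinerDet.

(** * Growing a ball inside a convex set *)

Section Spread.
Context {R : realType} {n : nat}.
Implicit Types (K : set 'rV[R]_n) (x y q u : 'rV[R]_n) (d h : R).

(** A bulge of K over the unit sphere near q.  The height d and the width h are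
    separate because d shrinks in an uncontrolled way during the iteration while
    h has to stay above the mesh of the net. *)
Definition local_gain K d h q := forall y, nrm y < 1 + d -> nrm (y - q) < h -> K y.

Definition mirror u x := x - (2 * dot x u) *: u.

Lemma mirror_involutive u : nrm u = 1 -> involutive (mirror u).
Proof.
move=> u1 x; rewrite /mirror !dotE -(sqr_nrm u) u1.
by apply/rowP => i; rewrite !mxE; ring.
Qed.

Lemma mirrorB u x y : mirror u x - mirror u y = mirror u (x - y).
Proof. by rewrite /mirror !dotE; apply/rowP => i; rewrite !mxE; ring. Qed.

Lemma nrm_mirror u x : nrm u = 1 -> nrm (mirror u x) = nrm x.
Proof.
move=> u1; rewrite /nrm; congr Num.sqrt.
by rewrite /mirror !dotE (dotC u x) -(sqr_nrm u) u1; ring.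
Qed.

Lemma dot_mirror u x : nrm u = 1 -> dot (mirror u x) u = - dot x u.
Proof. by move=> u1; rewrite /mirror !dotE -(sqr_nrm u) u1; ring. Qed.

Lemma steiner_mirror u K x : nrm u = 1 ->
  steiner u K (mirror u x) -> steiner u K x.
Proof.
move=> u1 [a [b [Ka Kb]]]; rewrite dot_mirror // normrN => h.
exists (a - 2 * dot x u), (b - 2 * dot x u); split; last by lra.
- have -> // : x + (a - 2 * dot x u) *: u = mirror u x + a *: u.
  by apply/rowP => i; rewrite !mxE; ring.
- have -> // : x + (b - 2 * dot x u) *: u = mirror u x + b *: u.
  by apply/rowP => i; rewrite !mxE; ring.
Qed.

Lemma steinerN u K x : steiner (- u) K x -> steiner u K x.
Proof.
move=> [a [b [Ka Kb h]]]; exists (- b), (- a); split.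
- by rewrite scaleNr -scalerN.
- by rewrite scaleNr -scalerN.
- by move: h; rewrite dotNr normrN; lra.
Qed.

(** Let y be near q with |y| slightly more than 1, and let c be its component
    along u.  On the side of y the fibre can be prolonged inside the part of K
    near q.  At the mirror image of y the fibre either still is near q, if c is
    small, or enters the unit ball after an amount that is quadratically small,
    if c is not.  In both cases the prolongation wins, so y lies in the
    symmetrized set, and so does its mirror image.  The loss h - h' can be
    taken as small as desired and d' depends on none of K, u and q, which allows
    a number of iterations fixed in advance. *)
Lemma local_gain_spread d h h' : 0 < d -> h' < h ->
  exists2 d', 0 < d' & forall K u q, nrm u = 1 -> open_ball 1 `<=` K ->
    local_gain K d h q ->
    local_gain (steiner u K) d' h' q /\ local_gain (steiner u K) d' h' (mirror u q).
Proof.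
move=> d0 hh; set g := h - h'; have g0 : 0 < g by rewrite subr_gt0.
(* k prolongs the fibre near q and k' < k shortens it at the mirror end; the
   bound d' <= k'^2 makes that shortening enough to enter the unit ball *)
set k := Num.min (d / 2) (g / 8).
have k0 : 0 < k by rewrite lt_min !divr_gt0.
have kd : k <= d / 2 by rewrite ge_min lexx.
have kg : k <= g / 8 by rewrite ge_min lexx orbT.
set k' := k / 2; have k'0 : 0 < k' by rewrite divr_gt0.
set d' := Num.min (Num.min 1 (d / 2)) (k' ^+ 2).
have d'0 : 0 < d' by rewrite !lt_min ltr01 divr_gt0 //= exprn_gt0.
have d'1 : d' <= 1 by rewrite !ge_min lexx.
have d'd : d' <= d / 2 by rewrite !ge_min lexx orbT.
have d'k : d' <= k' ^+ 2 by rewrite !ge_min lexx !orbT.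
exists d' => //.
suff H K u q : nrm u = 1 -> open_ball 1 `<=` K -> local_gain K d h q ->
    local_gain (steiner u K) d' h' q.
  move=> K u q u1 BK Kq; split; first exact: H.
  move=> y y1 yq; apply: steiner_mirror => //; apply: (H K u q) => //.
    by rewrite nrm_mirror.
  by rewrite -(nrm_mirror _ u1) -mirrorB mirror_involutive in yq.
move=> u1 BK Kq y y1 yq.
wlog c0 : u u1 / 0 <= dot y u.
  move=> W; have [|c0] := leP 0 (dot y u); first exact: W.
  by apply: steinerN; apply: W; rewrite ?nrmN // dotNr oppr_ge0 ltW.
set c := dot y u in c0 *.
have near s : nrm (y + s *: u - y) = `|s|.
  by rewrite addrC addKr nrmZ u1 mulr1.
have K1 s : (c + s) ^+ 2 <= (c + k) ^+ 2 -> `|s| < g -> K (y + s *: u).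
  move=> s2 sg; apply: Kq.
    rewrite nrm_lt; last by lra.
    have -> : s = (c + s) - c by ring.
    rewrite dot_line // -/c.
    have yy : dot y y < (1 + d') ^+ 2 by rewrite -nrm_lt //; lra.
    have cc : c <= 1 + d'.
      apply: le_trans (ltW y1).
      by have := le_trans (ler_norm _) (cauchy_schwarz y u); rewrite u1 mulr1.
    have := ler_wpM2l (ltW k0) cc.
    have : (1 + d' + k) ^+ 2 <= (1 + d) ^+ 2.
      by rewrite ler_pXn2r ?nnegrE //; lra.
    lra.
  have -> : y + s *: u - q = (y - q) + (y + s *: u - y).
    by apply/rowP => i; rewrite !mxE; ring.
  by apply: le_lt_trans (nrmD _ _) _; rewrite near /g in sg *; lra.
have Kk : K (y + k *: u) by apply: K1 => //; rewrite gtr0_norm //; lra.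
have [cg|cg] := ltP c (g / 4).
  (* both ends of the fibre are near q *)
exists (- (2 * c) - k), k; split => //.
    apply: K1; first by rewrite -sqrrN; have -> : - (c + (- (2 * c) - k)) = c + k by ring.
    by rewrite ltr0_norm; lra.
  by rewrite -/c ger0_norm //; lra.
(* the far end is inside the unit ball *)
exists (- (2 * c) + k'), k; split => //; last first.
  by rewrite -/c ger0_norm // /k'; lra.
apply: BK; rewrite /open_ball /= nrm_lt //.
have -> : - (2 * c) + k' = (- c + k') - c by ring.
rewrite dot_line // -/c.
have yy : dot y y < (1 + d') ^+ 2 by rewrite -nrm_lt //; lra.
have ck : 4 * k' <= c by rewrite /k'; lra.
have := ler_wpM2l (ltW k'0) ck.
have := ler_wpM2l (ltW d'0) d'1.
lra.
Qed.

(** Cubes of side 1 / M covering the unit sphere.  They provide both the finite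
    nets of directions and, in [thick], the partition of the sphere in small
    pieces. *)
Definition grid_cell (M : nat) (f : {ffun 'I_n -> 'I_(2 * M).+1}) : set 'rV[R]_n :=
  [set w | forall i, (f i)%:R <= (w 0 i + 1) * M%:R < (f i).+1%:R].

Lemma grid_cell_cover M w : nrm w = 1 -> exists f, @grid_cell M f w.
Proof.
move=> w1.
have wi i : 0 <= w 0 i + 1 <= 2.
  have := coord_le_nrm w i; rewrite w1 ler_norml => /andP[h1 h2].
  by apply/andP; split; lra.
have lt_w i : (Num.truncn ((w 0 i + 1) * M%:R)%R < (2 * M).+1)%N.
  have /andP[h1 h2] := wi i.
  rewrite ltnS -(ler_nat R); apply: (@le_trans _ _ ((w 0 i + 1) * M%:R)).
    by rewrite truncn_le mulr_ge0.
  by rewrite natrM ler_wpM2r.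
exists [ffun i => Ordinal (lt_w i)] => i; rewrite ffunE /=.
have /andP[h1 h2] := wi i.
by rewrite truncn_itv // mulr_ge0.
Qed.

Lemma grid_cell_diam M f x y : (0 < M)%N -> @grid_cell M f x -> @grid_cell M f y ->
  nrm (x - y) <= n%:R / M%:R.
Proof.
move=> M0 fx fy; have M0' : 0 < M%:R :> R by rewrite ltr0n.
apply: nrm_le_coord; first by rewrite invr_ge0.
move=> i; rewrite !mxE -(ler_pM2r M0') mulVf ?gt_eqF //.
have -> : `|x 0 i - y 0 i| * M%:R = `|(x 0 i + 1) * M%:R - (y 0 i + 1) * M%:R|.
  by rewrite -mulrBl normrM (ger0_norm (ler0n _ _)); congr (`|_| * _); ring.
have /andP[] := fx i; have /andP[] := fy i.
by rewrite -[(f i).+1]addn1 natrD ler_norml => *; apply/andP; split; lra.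
Qed.

Lemma grid_cell_fine (h : R) : 0 < h -> exists2 M, (0 < M)%N & n%:R / M%:R < h.
Proof.
move=> h0; have nh : 0 <= n%:R / h by rewrite divr_ge0 // ltW.
exists (Num.truncn (n%:R / h)).+1 => //.
have := truncnS_gt (n%:R / h).
by rewrite ltr_pdivrMr // => H; rewrite ltr_pdivrMr ?ltr0n // mulrC.
Qed.

Lemma sphere_net (h : R) : 0 < h -> exists ps : seq 'rV[R]_n,
  (forall p, p \in ps -> nrm p = 1) /\
  (forall w, nrm w = 1 -> exists2 p, p \in ps & nrm (w - p) < h).
Proof.
move=> /grid_cell_fine[M M0 Mh].
pose pk (f : {ffun 'I_n -> 'I_(2 * M).+1}) : option 'rV[R]_n :=
  if pselect (exists p, nrm p = 1 /\ grid_cell f p) is left e then Some (sval (cid e))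
  else None.
exists (pmap pk (enum {: {ffun 'I_n -> 'I_(2 * M).+1}})); split.
  move=> p; rewrite mem_pmap => /mapP[f _]; rewrite /pk.
  by case: pselect => // e [->]; case: cid => /= ? [].
move=> w w1; have [f fw] := grid_cell_cover M w1.
have e : exists p, nrm p = 1 /\ grid_cell f p by exists w.
exists (sval (cid e)).
  rewrite mem_pmap; apply/mapP; exists f; first by rewrite mem_enum.
  rewrite /pk; case: pselect => // e'; congr (Some (sval (cid _))).
  exact: Prop_irrelevance.
case: cid => p [_ fp] /=; apply: le_lt_trans Mh; exact: grid_cell_diam fw fp.
Qed.

End Spread.

Section Improve.
Context {R : realType} {n : nat}.
Implicit Types (K : set 'rV[R]_n.+1) (x y q u e p : 'rV[R]_n.+1) (d h t : R).

(** The reflection along p - e exchanges e and p.  If p - e has zero first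
    coordinate its direction u is rotated slightly towards the first basis
    vector b, which is orthogonal to u. *)
Lemma mirror_to e p t : nrm e = 1 -> nrm p = 1 -> e != p -> 0 < t ->
  exists2 u, transverse u & nrm (mirror u e - p) < t.
Proof.
move=> e1 p1 ep t0; set v := p - e.
have v0 : 0 < nrm v by apply: nrm_gt0; rewrite subr_eq0 eq_sym.
set u := (nrm v)^-1 *: v.
have u1 : nrm u = 1.
  by rewrite nrmZ ger0_norm ?invr_ge0 ?nrm_ge0 // mulVf // gt_eqF.
have ue : mirror u e = p.
  have ev : 2 * dot e v = - nrm v ^+ 2.
    have := sqr_nrm e; have := sqr_nrm p; rewrite e1 p1 sqr_nrm /v !dotE (dotC p e).
    by move=> h1 h2; lra.
  have -> : p = e + v by rewrite addrC subrK.
  rewrite /mirror /u dotZr scalerA mulrCA ev; congr (_ + _).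
  rewrite -scaleNr mulrC mulrN mulrN opprK mulrC expr2.
  by rewrite mulKf ?gt_eqF // divff ?gt_eqF // scale1r.
clearbody u v.
have [u0|u0] := eqVneq (u 0 0) 0; last first.
  by exists u => //; rewrite ue subrr nrm0.
pose b : 'rV[R]_n.+1 := delta_mx 0 0.
have ub : dot u b = 0 by rewrite dot_delta.
(* u' is u rotated by an angle theta with tan (theta / 2) = s; the mirror
   image of e moves by at most 4 |u' - u| <= 8 s *)
pose s := t / 9; have s0 : 0 < s by rewrite divr_gt0.
have s1 : 0 < 1 + s ^+ 2 by rewrite addr_gt0 // exprn_gt0.
pose u' := (1 + s ^+ 2)^-1 *: ((1 - s ^+ 2) *: u + (2 * s) *: b).
have bb : dot b b = 1 by rewrite -sqr_nrm nrm_delta expr1n.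
have uu : dot u u = 1 by rewrite -sqr_nrm u1 expr1n.
have u'1 : nrm u' = 1.
  rewrite -[RHS]sqrtr1 /nrm; congr Num.sqrt.
  rewrite /u' !dotE (dotC b u) ub bb uu.
  by field; rewrite gt_eqF.
have du : nrm (u' - u) <= 2 * s.
  rewrite nrm_le; last by rewrite mulr_ge0 // ltW.
  have -> : u' - u = (1 + s ^+ 2)^-1 *: ((- (2 * s ^+ 2)) *: u + (2 * s) *: b).
    by apply/rowP => i; rewrite !mxE; field; rewrite gt_eqF.
  rewrite !dotE (dotC b u) ub bb uu.
  apply: (@le_trans _ _ ((2 * s) ^+ 2 / (1 + s ^+ 2))).
    by rewrite le_eqVlt; apply/orP; left; apply/eqP; field; rewrite gt_eqF.
  by rewrite ler_pdivrMr // ler_peMr ?sqr_ge0 // lerDl sqr_ge0.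
have u'0 : u' 0 0 != 0.
  rewrite /u' !mxE u0 !eqxx mulr0 add0r mulr1.
  by rewrite mulf_neq0 ?invr_eq0 ?gt_eqF // mulr_gt0.
exists u'; [by split|clearbody u'].
rewrite -ue.
have -> : mirror u' e - mirror u e =
    (- (2 * dot e (u' - u))) *: u' - (2 * dot e u) *: (u' - u).
  by rewrite /mirror !dotE; apply/rowP => i; rewrite !mxE; ring.
apply: le_lt_trans (nrmD _ _) _.
rewrite nrmN !nrmZ normrN !normrM u'1 mulr1 ger0_norm //.
have h1 := cauchy_schwarz e (u' - u); rewrite e1 mul1r in h1.
have h2 := cauchy_schwarz e u; rewrite e1 u1 mul1r in h2.
have h3 := ler_wpM2r (nrm_ge0 (u' - u)) h2.
have st : s = t / 9 by [].
lra.
Qed.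

Lemma local_gain_sub K d d' h h' q q' : d' <= d -> nrm (q' - q) <= h - h' ->
  local_gain K d h q -> local_gain K d' h' q'.
Proof.
move=> dd hh Kq y y1 y2; apply: Kq; first by apply: lt_le_trans y1 _; rewrite lerD2l.
have -> : y - q = (y - q') + (q' - q) by rewrite addrA subrK.
by apply: le_lt_trans (nrmD _ _) _; lra.
Qed.

(** The number of points of the net is fixed before any symmetrization, so the
    margin h - h' can be shared out between them. *)
Lemma local_gain_cover (ps : seq 'rV[R]_n.+1) : (forall p, p \in ps -> nrm p = 1) ->
  forall d h h', 0 < d -> h' < h ->
  exists2 d', 0 < d' & forall K e, nrm e = 1 -> open_ball 1 `<=` K -> local_gain K d h e ->
    exists us, [/\ all_transverse us, open_ball 1 `<=` symmetrize us K,
      local_gain (symmetrize us K) d' h' e &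
      forall p, p \in ps -> local_gain (symmetrize us K) d' h' p].
Proof.
elim: ps => [|p ps IH] ps1 d h h' d0 hh.
  exists d => // K e e1 BK Ke; exists [::]; split => //.
  by apply: local_gain_sub Ke; rewrite // subrr nrm0; lra.
set h2 := (h + h') / 2; set h3 := (h2 + h') / 2.
have ps1' q : q \in ps -> nrm q = 1 by move=> qp; apply: ps1; rewrite inE qp orbT.
have [|d1 d10 H] := IH ps1' d h h2 d0; first by rewrite /h2; lra.
have [|d2 d20 H2] := @local_gain_spread R n.+1 d1 h2 h3 d10.
  by rewrite /h3 /h2; lra.
exists (Num.min d1 d2); first by rewrite lt_min d10.
have p1 : nrm p = 1 by apply: ps1; rewrite inE eqxx.
have m1 : Num.min d1 d2 <= d1 by rewrite ge_min lexx.
have m2 : Num.min d1 d2 <= d2 by rewrite ge_min lexx orbT.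
move=> K e e1 BK Ke; have [us [us1 Bus ge gp]] := H K e e1 BK Ke.
have le0 q : nrm (q - q) <= h2 - h' by rewrite subrr nrm0 /h2; lra.
have le0' q : nrm (q - q) <= h3 - h' by rewrite subrr nrm0 /h3 /h2; lra.
have [ep|ep] := eqVneq e p.
  exists us; split => //; first exact: local_gain_sub ge.
  move=> q; rewrite inE => /orP[/eqP ->|/gp Kq]; last exact: local_gain_sub Kq.
  by rewrite -ep; exact: local_gain_sub ge.
have [|u [u1 u0] ue] := @mirror_to e p (h3 - h') e1 p1 ep.
  by rewrite /h3 /h2; lra.
exists (u :: us); split.
- by apply/all_transverse_cons.
- exact: steiner_ball.
- by have [h4 _] := H2 _ u e u1 Bus ge; exact: local_gain_sub h4.
move=> q; rewrite inE => /orP[/eqP ->|/gp Kq].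
  have [_ h4] := H2 _ u e u1 Bus ge.
  by apply: local_gain_sub h4 => //; rewrite nrmB ltW.
by have [h4 _] := H2 _ u q u1 Bus Kq; exact: local_gain_sub h4.
Qed.

(** If x is in K and |x| >= t, then with e = x / |x| the convex hull of x and the
    unit ball contains the ball of radius 1 - 1 / t around e.  This gain is then
    copied to a finite net of the sphere. *)
Lemma ball_grows (t : R) : 1 < t -> exists2 eps : R, 0 < eps &
  forall K x, euclid_convex K -> open_ball 1 `<=` K -> K x -> t <= nrm x ->
  exists2 us, all_transverse us & open_ball (1 + eps) `<=` symmetrize us K.
Proof.
move=> t1; set h := 1 - t^-1.
have t0 : 0 < t := lt_trans ltr01 t1.
have h0 : 0 < h by rewrite subr_gt0 invf_lt1.
have [|ps [ps1 net]] := @sphere_net R n.+1 (h / 4); first by rewrite divr_gt0.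
have [|d' d'0 H] := local_gain_cover ps1 (h := h) (h' := h / 2) (@ltr01 R).
  by lra.
exists (Num.min d' (h / 4)); first by rewrite lt_min d'0 divr_gt0.
move=> K x cK BK Kx tx.
have x0 : 0 < nrm x := lt_le_trans t0 tx.
set e := (nrm x)^-1 *: x.
have e1 : nrm e = 1.
  by rewrite nrmZ ger0_norm ?invr_ge0 ?nrm_ge0 // mulVf // gt_eqF.
have lx : h <= 1 - (nrm x)^-1 by rewrite lerD2l lerN2 lef_pV2.
have Ke : local_gain K 1 h e.
  move=> y _ ye; have l0 : 0 < 1 - (nrm x)^-1 := lt_le_trans h0 lx.
  have -> : y = (nrm x)^-1 *: x +
      (1 - (nrm x)^-1) *: ((1 - (nrm x)^-1)^-1 *: (y - e)).
    by rewrite scalerA divff ?gt_eqF // scale1r -/e addrC subrK.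
  apply: cK => //; last by rewrite invr_ge0 ltW //= -subr_ge0 ltW.
  apply: BK; rewrite /open_ball /= nrmZ ger0_norm ?invr_ge0 ?(ltW l0) //.
  by rewrite mulrC ltr_pdivrMr // mul1r (lt_le_trans ye).
have [us [us1 Bus ge gp]] := H K e e1 BK Ke.
exists us => // y; rewrite /open_ball /= => ye.
have [|y1] := ltP (nrm y) 1; first exact: Bus.
have y0 : 0 < nrm y := lt_le_trans ltr01 y1.
have [|p pps wp] := net ((nrm y)^-1 *: y).
  by rewrite nrmZ ger0_norm ?invr_ge0 ?nrm_ge0 // mulVf // gt_eqF.
have [m1 m2] : Num.min d' (h / 4) <= d' /\ Num.min d' (h / 4) <= h / 4.
  by rewrite !ge_min !lexx orbT.
apply: (gp p pps); first by lra.
have -> : y - p = (1 - (nrm y)^-1) *: y + ((nrm y)^-1 *: y - p).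
  by apply/rowP => i; rewrite !mxE; ring.
apply: le_lt_trans (nrmD _ _) _.
rewrite nrmZ ger0_norm ?subr_ge0 ?invf_le1 //.
by rewrite mulrBl mul1r mulVf ?gt_eqF //; lra.
Qed.

End Improve.

(** * Balls of prescribed radii and the determinant bound *)

Section Growth.
Context {R : realType} {n : nat}.
Implicit Types (K C : set 'rV[R]_n.+1) (x y u : 'rV[R]_n.+1) (r s rho : R).

Lemma symmetrize_cat us vs K : symmetrize (us ++ vs) K = symmetrize us (symmetrize vs K).
Proof. exact: foldr_cat. Qed.

Lemma symmetrize_scale us K r : 0 < r ->
  symmetrize us [set x | K (r *: x)] = [set x | symmetrize us K (r *: x)].
Proof.
move=> r0; elim: us => //= u us ->; apply/seteqP; split=> x /= [a [b [Ka Kb h]]].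
  exists (r * a), (r * b); split.
  - by rewrite -scalerA -scalerDr.
  - by rewrite -scalerA -scalerDr.
  - by rewrite dotZl normrM gtr0_norm // mulrCA -mulrBr ltr_pM2l.
exists (r^-1 * a), (r^-1 * b); split.
- by rewrite /= scalerDr !scalerA mulrA divff ?gt_eqF // mul1r.
- by rewrite /= scalerDr !scalerA mulrA divff ?gt_eqF // mul1r.
- move: h; rewrite dotZl normrM gtr0_norm // => h.
  by rewrite -mulrBr -(ltr_pM2l r0) mulVKf ?gt_eqF // mulrCA.
Qed.

(** The hypothesis on all iterated symmetrizations holds when K has more volume
    than the ball of radius rho.  Rescaling so that the ball already inside has
    radius 1, the far point is at distance at least t = rho / s, so the gain
    factor is the same at every step. *)
Lemma ball_reaches K s0 s rho : euclid_convex K -> 0 < s0 -> 0 < s -> s < rho ->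
  open_ball s0 `<=` K ->
  (forall us, all_transverse us -> exists2 x, symmetrize us K x & rho <= nrm x) ->
  exists2 us, all_transverse us & open_ball s `<=` symmetrize us K.
Proof.
move=> cK s00 sp srho s0K far.
have [|e e0 H] := @ball_grows R n (rho / s); first by rewrite ltr_pdivlMr ?mul1r.
suff W k : exists2 us, all_transverse us &
    open_ball (Num.min s (s0 * (1 + e) ^+ k)) `<=` symmetrize us K.
  pose k := (Num.truncn (s / (s0 * e))).+1.
  have [us us1 Bus] := W k; exists us => //.
  suff ss : s <= s0 * (1 + e) ^+ k by move: Bus; rewrite min_l.
  have : s / (s0 * e) <= k%:R by apply/ltW/truncnS_gt.
  rewrite ler_pdivrMr ?mulr_gt0 // => h.
  have bern m : 1 + m%:R * e <= (1 + e) ^+ m.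
    elim: m => [|m IHm]; first by rewrite mul0r addr0.
    have e1 : 0 <= 1 + e by lra.
    rewrite exprS; apply: le_trans (ler_wpM2l e1 IHm).
    rewrite -[m.+1]addn1 natrD.
    have : 0 <= m%:R * (e * e) by rewrite !mulr_ge0 // ltW.
    lra.
  have := ler_wpM2l (ltW s00) (bern k); lra.
elim: k => [|k [us us1 Bus]].
  exists [::] => // x; rewrite /open_ball /= => xs; apply: s0K.
  by apply: lt_le_trans xs _; rewrite expr0 mulr1 ge_min lexx orbT.
set r := Num.min s _ in Bus.
have r0 : 0 < r by rewrite lt_min sp mulr_gt0 // exprn_gt0 // addr_gt0.
have rs : r <= s by rewrite ge_min lexx.
have [x Kx rx] := far us us1.
have [||||vs vs1] := H [set x | symmetrize us K (r *: x)] (r^-1 *: x).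
- have : euclid_convex (symmetrize us K).
    by apply: (@symmetrize_ind _ _ euclid_convex) => // u C _; exact: steiner_convex.
  move=> cS y z t /= Ky Kz t01.
  have -> : r *: (t *: y + (1 - t) *: z) = t *: (r *: y) + (1 - t) *: (r *: z).
    by apply/rowP => i; rewrite !mxE; ring.
  exact: cS.
- move=> y y1; apply: Bus; rewrite /open_ball /= nrmZ gtr0_norm //.
  by rewrite -[ltRHS]mulr1 ltr_pM2l.
- by rewrite /= scalerA divff ?gt_eqF // scale1r.
- rewrite nrmZ gtr0_norm ?invr_gt0 // [leRHS]mulrC; apply: ler_pM => //.
  + exact/ltW/(lt_trans sp).
  + by rewrite invr_ge0 ltW.
  + by rewrite lef_pV2.
rewrite symmetrize_scale // -symmetrize_cat => Bvs.
exists (vs ++ us); first exact: all_transverse_cat.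
move=> y; rewrite /open_ball /= lt_min => /andP[ys yk].
have := Bvs (r^-1 *: y); rewrite /= scalerA divff ?gt_eqF // scale1r; apply.
rewrite /open_ball /= nrmZ gtr0_norm ?invr_gt0 // mulrC ltr_pdivrMr //.
have [rE|rE] := leP s (s0 * (1 + e) ^+ k).
  rewrite /r min_l //; have := mulr_gt0 e0 sp; lra.
by rewrite /r min_r ?(ltW rE) // mulrCA -exprS.
Qed.

Lemma row_det_diag (s : 'I_n.+1 -> R) :
  row_det (fun j => s j *: delta_mx 0 j) = \prod_j s j.
Proof.
rewrite /row_det (_ : \matrix_i _ = diag_mx (\row_j s j)).
  by rewrite det_diag; apply: eq_bigr => i _; rewrite mxE.
apply/matrixP => i j; rewrite !mxE eqxx /= eq_sym.
by case: eqP => // _; rewrite ?mulr1 ?mulr0.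
Qed.

(** The bound D holds for the symmetrized hulls, which contain the orthogonal
    vectors s_j e_j.  The directions that make the ball grow for one index do not
    destroy the balls obtained before for the others. *)
Theorem det_prod_radii (U : 'I_n.+1 -> set 'rV[R]_n.+1) D
    (s rho : 'I_n.+1 -> R) :
  (forall j, euclid_open (U j)) -> (forall j, U j !=set0) -> det_bounded U D ->
  (forall j, 0 < s j < rho j) ->
  (forall j us, all_transverse us ->
     exists2 x, symmetrize us (symhull (U j)) x & rho j <= nrm x) ->
  \prod_j s j <= D.
Proof.
move=> oU U0 UD srho far.
pose C j := symhull (U j).
(* any radius strictly between s j and rho j makes room for
   the vector s_j e_j in the open ball *)
suff [us us1 Bus] : exists2 us, all_transverse us &
    forall j, open_ball ((s j + rho j) / 2) `<=` symmetrize us (C j).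
  have := @symmetrize_det _ _ us C D us1 (symhull_det UD) (fun j => s j *: delta_mx 0 j).
  rewrite row_det_diag => H; apply: le_trans (ler_norm _) (H _) => j.
  have /andP[sj rj] := srho j.
  by apply: Bus; rewrite /open_ball /= nrmZ nrm_delta gtr0_norm //; lra.
suff H (l : seq 'I_n.+1) : exists2 us, all_transverse us &
    forall j, j \in l -> open_ball ((s j + rho j) / 2) `<=` symmetrize us (C j).
  have [us us1 Bus] := H (enum 'I_n.+1).
  by exists us => // j; apply: Bus; rewrite mem_enum.
have Bsym us r : all_transverse us -> forall K,
    open_ball r `<=` K -> open_ball r `<=` symmetrize us K.
  move=> us1 K; apply: (@symmetrize_ind _ _ (fun K => open_ball r `<=` K)) us1 => u X [u1 _].
  exact: steiner_ball.
elim: l => [|k l [us us1 Bus]]; first by exists [::].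
have /andP[sj rj] := srho k.
have [r0 r00 r0C] := symhull_ball (oU k) (U0 k).
have [||||||vs vs1 Bvs] := @ball_reaches (symmetrize us (C k)) r0 ((s k + rho k) / 2) (rho k).
- apply: (@symmetrize_ind _ _ euclid_convex) => // [u X _|].
    exact: steiner_convex.
  exact: hull_convex.
- by [].
- by lra.
- by lra.
- exact: Bsym.
- by move=> vs vs1; rewrite -symmetrize_cat; apply: far; exact: all_transverse_cat.
exists (vs ++ us); first exact: all_transverse_cat.
move=> j; rewrite symmetrize_cat inE => /orP[/eqP -> //|/Bus]; exact: Bsym.
Qed.

End Growth.

(** * Lebesgue measure on tuples *)

Section Lebesgue.
Context {R : realType}.
Local Notation T n := (n.-tuple (measurableTypeR R)).
Local Notation leb n := (power_measure (@lebesgue_measure R) (n:=n)).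

Definition vec n (t : n.-tuple R) : 'rV[R]_n := \row_i tnth t i.

Lemma measurable_slab n (i : 'I_n) (a b : R) :
  measurable [set t : T n | a < @tnth n R t i < b].
Proof.
have := @measurable_tnth _ (measurableTypeR R) n i measurableT `]a, b[%classic
  (measurable_itv _).
rewrite setTI; congr measurable; apply/seteqP; split => t /=; by rewrite in_itv.
Qed.

(** The sigma-algebra on tuples is the product one, so an open set is written as
    a countable union of rational boxes. *)
Lemma euclid_open_measurable n (K : set 'rV[R]_n) : euclid_open K ->
  measurable [set t : T n | K (vec t)].
Proof.
move=> oK.
pose lo (w : {ffun 'I_n -> rat} * nat) i : R := @ratr R (w.1 i) - w.2.+1%:R^-1.
pose hi (w : {ffun 'I_n -> rat} * nat) i : R := @ratr R (w.1 i) + w.2.+1%:R^-1.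
pose box w : set (T n) := [set t | forall i, lo w i < @tnth n R t i < hi w i].
pose F w := if pselect (forall t, box w t -> K (vec t)) then box w else set0.
have -> : [set t : T n | K (vec t)] = \bigcup_w F w.
  apply/seteqP; split=> [t /= /oK[e e0 he]|t [w _]]; last first.
    by rewrite /F; case: pselect => // wK /wK.
  pose k := Num.truncn (2 * n%:R / e).
  have k0 : 0 < k.+1%:R :> R by rewrite ltr0n.
  have ke : 2 * n%:R / k.+1%:R < e.
    have := truncnS_gt (2 * n%:R / e); rewrite ltr_pdivrMr // => h.
    by rewrite ltr_pdivrMr // [ltRHS]mulrC.
  have near i : exists q : rat,
      @tnth n R t i - k.+1%:R^-1 < @ratr R q < @tnth n R t i + k.+1%:R^-1.
    have [|q] := @rat_in_itvoo R (@tnth n R t i - k.+1%:R^-1) (@tnth n R t i + k.+1%:R^-1).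
      by rewrite ltrBlDr -addrA ltrDl addr_gt0 // invr_gt0.
    by rewrite in_itv /= => h; exists q.
  have [q hq] := choice near.
  exists ([ffun i => q i], k) => //; rewrite /F; case: pselect => /= [_|[]].
    move=> i; rewrite /lo /hi ffunE /=; have /andP[h1 h2] := hq i.
    by rewrite ltrBlDr h2 -ltrBlDr.
  move=> s /= sq; apply: he.
  apply: le_lt_trans ke; rewrite mulrAC mulrC.
  apply: nrm_le_coord; first by rewrite divr_ge0.
  move=> i; rewrite !mxE ler_norml.
  have := sq i; rewrite /lo /hi ffunE /= => /andP[].
  have /andP[] := hq i; move: (ratr (q i)) (k.+1%:R^-1) => r v.
  move: (@tnth n R s i) (@tnth n R t i) => a b *; by apply/andP; split; lra.
apply: countable_bigcupT_measurable; first exact: countableP.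
move=> w; rewrite /F; case: pselect => //= ?.
rewrite (_ : box w = \bigcap_(i in [set: 'I_n])
    [set t : T n | lo w i < @tnth n R t i < hi w i]).
  by apply: fin_bigcap_measurable => // i _; exact: measurable_slab.
by apply/seteqP; split => t h i; [move=> _|]; exact: h.
Qed.

Lemma power_measureS n (A : set (T n.+1)) : leb n.+1 A =
  (\int[@lebesgue_measure R]_x leb n [set t : T n | A [tuple of x :: t]])%E.
Proof. by []. Qed.

Lemma measurable_pairs n (A : set (T n.+1)) : measurable A ->
  measurable [set w : measurableTypeR R * T n | A [tuple of w.1 :: w.2]].
Proof.
move=> mA; rewrite -[X in measurable X]setTI.
exact: (@measurable_cons _ _ (measurableTypeR R * T n)%type (measurableTypeR R) fst n snd).
Qed.

Lemma measurable_section n (A : set (T n.+1)) x : measurable A ->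
  measurable [set t : T n | A [tuple of x :: t]].
Proof.
move=> mA; have := measurable_xsection x (measurable_pairs mA).
by congr measurable; apply/seteqP; split => t; rewrite /xsection /= inE.
Qed.

Lemma measurable_section_measure n (A : set (T n.+1)) : measurable A ->
  measurable_fun [set: measurableTypeR R]
    (fun x => leb n [set t : T n | A [tuple of x :: t]]).
Proof.
move=> mA; have := measurable_fun_xsection (leb n) (measurable_pairs mA).
congr measurable_fun; apply/funext => x /=; congr (power_measure _ _).
by apply/seteqP; split => t; rewrite /xsection /= inE.
Qed.

Lemma integral_affine (f : measurableTypeR R -> \bar R) (c w : R) : 0 < c ->
  measurable_fun [set: measurableTypeR R] f -> (forall x, 0 <= f x)%E ->
  (\int[@lebesgue_measure R]_x f x =
   c%:E * \int[@lebesgue_measure R]_x f (c * x + w)%R)%E.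
Proof.
move=> c0 mf f0.
pose phi (x : measurableTypeR R) : measurableTypeR R := c * x + w.
have mphi : measurable_fun setT phi.
  by apply: measurable_funD => //; apply: measurable_funM.
pose m := [the {measure set (measurableTypeR R) -> \bar R} of
  pushforward (@lebesgue_measure R) phi].
pose k : {nonneg R} := NngNum (ltW c0).
have E A : measurable A -> lebesgue_measure A = mscale k (m mphi) A.
  move=> mA; apply: lebesgue_measure_unique => // _ [[a b]] _ <-.
  transitivity (c%:E * lebesgue_measure (phi @^-1` `]a, b]%classic))%E; last by [].
  rewrite (_ : phi @^-1` _ = `](a - w) / c, (b - w) / c]%classic); last first.
    apply/seteqP; split => x /=; rewrite !in_itv /= /phi.
      by rewrite ltr_pdivrMr // ler_pdivlMr // (mulrC x) ltrBlDr lerBrDr.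
    by rewrite ltr_pdivrMr // ler_pdivlMr // (mulrC x) ltrBlDr lerBrDr.
  rewrite !lebesgue_measure_itv /= !lte_fin ltr_pM2r ?invr_gt0 // ltrD2r.
  case: ifP => _; last by rewrite mule0.
  by rewrite -!EFinD -EFinM; congr EFin; field; rewrite gt_eqF.
rewrite (@eq_measure_integral _ _ _ setT (mscale k (m mphi))); last first.
  by move=> A mA _; exact: E.
rewrite ge0_integral_mscale //; congr (_ * _)%E.
by rewrite ge0_integral_pushforward.
Qed.

Lemma measurable_affine n (c : R) (w : 'I_n -> R) (A : set (T n)) :
  measurable A ->
  measurable [set t : T n | A [tuple (c * tnth t i + w i)%R | i < n]].
Proof.
move=> mA; rewrite -[X in measurable X]setTI.
have : measurable_fun [set: T n]
    (fun t => [tuple (c * tnth t i + w i)%R | i < n] : T n).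
  apply/measurable_fun_tnthP => i.
  rewrite (_ : _ \o _ = fun t : T n => c * tnth t i + w i); last first.
    by apply/funext => t /=; rewrite tnth_mktuple.
  apply: measurable_funD => //; apply: measurable_funM => //.
  exact: measurable_tnth.
by apply.
Qed.

(** Translation invariance and homogeneity together, by induction on the
    dimension from the one-dimensional change of variables. *)
Lemma leb_affine n (c : R) (w : 'I_n -> R) (A : set (T n)) : 0 < c ->
  measurable A ->
  (leb n A = (c ^+ n)%:E *
    leb n [set t : T n | A [tuple (c * tnth t i + w i)%R | i < n]])%E.
Proof.
move=> c0; elim: n w A => [|n IH] w A mA.
  rewrite expr0 mul1e; congr (power_measure _ _).
  apply/funext => t; rewrite /mkset; congr (A _).
  by rewrite [LHS]tuple0 [RHS]tuple0.
rewrite !power_measureS (integral_affine (w ord0) c0); last 2 first.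
- exact: measurable_section_measure.
- by move=> x; exact: measure_ge0.
rewrite exprS EFinM -muleA; congr (_ * _)%E.
rewrite -ge0_integralZl//; last 2 first.
- exact: measurable_section_measure (measurable_affine c w mA).
- by rewrite lee_fin exprn_ge0 // ltW.
apply: eq_integral => x _.
rewrite (IH (fun i => w (lift ord0 i))); last exact: measurable_section.
congr (_ * power_measure _ _)%E; apply/seteqP; split => t /=.
  congr (A _); apply/eq_from_tnth => i; rewrite tnth_mktuple.
  by case: (unliftP ord0 i) => [j ->|->]; rewrite ?tnthS ?tnth0 ?tnth_mktuple.
congr (A _); apply/eq_from_tnth => i; rewrite tnth_mktuple.
by case: (unliftP ord0 i) => [j ->|->]; rewrite ?tnthS ?tnth0 ?tnth_mktuple.
Qed.

End Lebesgue.

(** * Volume under Steiner symmetrization *)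

Section SteinerVolume.
Context {R : realType}.
Local Notation T n := (n.-tuple (measurableTypeR R)).
Local Notation leb n := (power_measure (@lebesgue_measure R) (n:=n)).

Definition vol n (K : set 'rV[R]_n) : \bar R := leb n [set t : T n | K (vec t)].

(** E' contains the open interval centred at c whose length is the diameter of E,
    and the measure of E is at most that diameter. *)
Lemma measure_le_diameter (E E' : set (measurableTypeR R)) (c : R) :
  measurable E -> measurable E' ->
  (forall a b x : R, E a -> E b -> 2 * `|x - c| < b - a -> E' x) ->
  (lebesgue_measure E <= lebesgue_measure E')%E.
Proof.
move=> mE mE' H; rewrite leNgt; apply/negP => EE'.
have E'fin : lebesgue_measure E' \is a fin_num.
  by rewrite ge0_fin_numE // (lt_le_trans EE') // leey.
pose d := fine (lebesgue_measure E').
have dE : lebesgue_measure E' = d%:E by rewrite fineK.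
have d0 : 0 <= d by rewrite -lee_fin -dE.
have [[a [b [Ea Eb dab]]]|N] := pselect (exists a b : R, [/\ E a, E b & d < b - a]).
  have : (lebesgue_measure `](c - (b - a) / 2)%R, (c + (b - a) / 2)%R[%classic
            <= lebesgue_measure E')%E.
    apply: le_measure; [by rewrite inE; exact: measurable_itv|by rewrite inE|].
    move=> x /=; rewrite in_itv /= => /andP[h1 h2]; apply: (H a b x) => //.
    have : `|x - c| < (b - a) / 2 by rewrite ltr_norml ltrBrDl h1 ltrBlDl.
    lra.
  rewrite lebesgue_measure_itv /= lte_fin.
  have -> : c - (b - a) / 2 < c + (b - a) / 2 by lra.
  rewrite dE -EFinD lee_fin => h; clear -h dab; lra.
have [x0 Ex0] : E !=set0.
  apply/set0P/negP => /eqP E0; move: EE'; rewrite E0 measure0 dE lte_fin.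
  by rewrite ltNge d0.
have Ed (a b : R) : E a -> E b -> b - a <= d.
  by move=> Ea Eb; rewrite leNgt; apply/negP => h; apply: N; exists a, b.
pose m := inf (E : set R).
have lbE : has_lbound (E : set R).
  by exists (x0 - d) => y Ey; have := Ed y x0 Ey Ex0; lra.
have : (lebesgue_measure E <= lebesgue_measure `[m, (m + d)%R]%classic)%E.
  apply: le_measure; [by rewrite inE|by rewrite inE; exact: measurable_itv|].
  move=> x Ex /=; rewrite in_itv /=; apply/andP; split.
    exact: ge_inf.
  rewrite -lerBlDr; apply: lb_le_inf; first by exists x0.
  by move=> y Ey; have := Ed y x Ey Ex; lra.
rewrite lebesgue_measure_itv /= lte_fin; case: ifP => _.
  rewrite -EFinD (_ : m + d - m = d); last by ring.
  by rewrite -dE leNgt EE'.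
by rewrite leNgt (le_lt_trans _ EE') // dE lee_fin.
Qed.

Definition shear_tuple n (v : 'I_n -> R) (x : R) (t : T n) : T n :=
  [tuple (1 * tnth t i + x * v i)%R | i < n].

Lemma measurable_shear n (v : 'I_n -> R) (A : set (T n.+1)) : measurable A ->
  measurable [set w : measurableTypeR R * T n | A [tuple of w.1 :: shear_tuple v w.1 w.2]].
Proof.
move=> mA; rewrite -[X in measurable X]setTI.
apply: (@measurable_cons _ _ (measurableTypeR R * T n)%type (measurableTypeR R)
  fst n (fun w => shear_tuple v w.1 w.2)) => //.
apply/measurable_fun_tnthP => i.
rewrite (_ : _ \o _ =
    fun w : measurableTypeR R * T n => 1 * tnth w.2 i + w.1 * v i); last first.
  by apply/funext => w /=; rewrite tnth_mktuple.
apply: measurable_funD; apply: measurable_funM => //.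
apply: (@measurableT_comp _ _ _ _ _ _ (fun x : T n => tnth x i)) => //.
exact: measurable_tnth.
Qed.

(** Each slice is translated by x v, which does not change its measure; then the
    order of integration is exchanged, so that the inner integral runs along the
    lines of direction (1, v). *)
Lemma leb_shear n (v : 'I_n -> R) (A : set (T n.+1)) : measurable A ->
  leb n.+1 A = (\int[leb n]_t
    lebesgue_measure [set x : measurableTypeR R | A [tuple of x :: shear_tuple v x t]])%E.
Proof.
move=> mA; rewrite power_measureS.
pose B := [set w : measurableTypeR R * T n | A [tuple of w.1 :: shear_tuple v w.1 w.2]].
have mB : measurable B by exact: measurable_shear.
transitivity (\int[@lebesgue_measure R]_x (leb n \o xsection B) x)%E.
  apply: eq_integral => x _.
  rewrite (leb_affine (fun i => x * v i) (@ltr01 R)); last exact: measurable_section.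
  rewrite expr1n mul1e /=; congr (power_measure _ _).
  by apply/seteqP; split => t; rewrite /xsection /= inE.
rewrite -(@indic_fubini_tonelli_FE _ _ _ _ _ (leb n) _ mB).
rewrite (indic_fubini_tonelli (@lebesgue_measure R) (leb n) mB).
rewrite (@indic_fubini_tonelli_GE _ _ _ _ _ (@lebesgue_measure R) _ mB).
apply: eq_integral => t _ /=; congr lebesgue_measure.
by apply/seteqP; split => x; rewrite /ysection /= inE.
Qed.

Lemma measurable_shear_section n (v : 'I_n -> R) (A : set (T n.+1)) t :
  measurable A ->
  measurable [set x : measurableTypeR R | A [tuple of x :: shear_tuple v x t]].
Proof.
move=> mA; have := measurable_ysection t (measurable_shear v mA).
by congr measurable; apply/seteqP; split => x; rewrite /ysection /= inE.
Qed.

Lemma measurable_shear_measure n (v : 'I_n -> R) (A : set (T n.+1)) :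
  measurable A -> measurable_fun setT (fun t : T n =>
    lebesgue_measure [set x : measurableTypeR R | A [tuple of x :: shear_tuple v x t]]).
Proof.
move=> mA.
have := measurable_fun_ysection (@lebesgue_measure R) (measurable_shear v mA).
congr measurable_fun; apply/funext => x /=; congr lebesgue_measure.
by apply/seteqP; split => t; rewrite /ysection /= inE.
Qed.

(** On each line of direction u, parametrized by its first coordinate,
    the two sections compare by [measure_le_diameter]; the centre is the
    parameter of the point of the line that is orthogonal to u. *)
Lemma vol_steiner n (u : 'rV[R]_n.+1) (K : set 'rV[R]_n.+1) :
  transverse u -> euclid_open K -> (vol K <= vol (steiner u K))%E.
Proof.
move=> [u1 u0] oK; have oS := steiner_open u1 oK.
rewrite /vol.
pose v i := u 0 (lift ord0 i) / u 0 0.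
rewrite !(leb_shear v); try exact: euclid_open_measurable.
apply: ge0_le_integral => //.
- by apply: measurable_shear_measure; exact: euclid_open_measurable.
- by apply: measurable_shear_measure; exact: euclid_open_measurable.
move=> t _.
(* the points of the line over t, as y + (x / u_0) u *)
pose y : 'rV[R]_n.+1 := \row_i (if unlift ord0 i is Some j then @tnth n R t j else 0).
have lineE x : vec [tuple of x :: shear_tuple v x t] = y + (x / u 0 0) *: u.
  apply/rowP => i; rewrite !mxE; case: (unliftP ord0 i) => [j ->|->].
    by rewrite tnthS tnth_mktuple mul1r /v mulrA mulrAC.
  by rewrite tnth0 add0r divfK.
have uu : dot u u = 1 by rewrite -sqr_nrm u1 expr1n.
apply: (@measure_le_diameter _ _ (- u 0 0 * dot y u)).
- by apply: measurable_shear_section; exact: euclid_open_measurable.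
- by apply: measurable_shear_section; exact: euclid_open_measurable.
move=> a b x /=; rewrite !lineE => Ka Kb.
have xE z : y + (x / u 0 0) *: u + ((z - x) / u 0 0) *: u = y + (z / u 0 0) *: u.
  by apply/rowP => i; rewrite !mxE; field.
have dxE : dot (y + (x / u 0 0) *: u) u = (x - - u 0 0 * dot y u) / u 0 0.
  by rewrite !dotE uu; field.
move=> h.
have {}h : 2 * `|dot (y + (x / u 0 0) *: u) u| < (b - a) / `|u 0 0|.
  rewrite dxE normrM normfV mulrA ltr_pM2r // invr_gt0 normr_gt0 //.
have [up|un] := ltP 0 (u 0 0).
  exists ((a - x) / u 0 0), ((b - x) / u 0 0); rewrite !xE; split => //.
  have -> : (b - x) / u 0 0 - (a - x) / u 0 0 = (b - a) / u 0 0 by ring.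
  by rewrite (gtr0_norm up) in h.
have {}un : u 0 0 < 0 by rewrite lt_neqAle u0.
exists ((b - x) / u 0 0), ((a - x) / u 0 0); rewrite !xE; split => //.
have -> : (a - x) / u 0 0 - (b - x) / u 0 0 = (b - a) / - u 0 0.
  by field.
by rewrite (ltr0_norm un) in h.
Qed.

Lemma vol_symmetrize n us (K : set 'rV[R]_n.+1) : all_transverse us -> euclid_open K ->
  (vol K <= vol (symmetrize us K))%E.
Proof.
move=> us1 oK.
suff [] : euclid_open (symmetrize us K) /\ (vol K <= vol (symmetrize us K))%E by [].
apply: (@symmetrize_ind _ _ (fun C => euclid_open C /\ (vol K <= vol C)%E)) => //.
move=> u C uok [oC KC]; split; first by apply: steiner_open => //; case: uok.
by apply: le_trans KC _; exact: vol_steiner.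
Qed.

End SteinerVolume.

(** * Cones over the sphere and the volume of balls *)

Section Cone.
Context {R : realType} {n : nat}.
Local Notation T := (n.+1.-tuple (measurableTypeR R)).
Local Notation leb := (power_measure (@lebesgue_measure R) (n:=n.+1)).
Implicit Types (A : set (sphere R n)) (s : sphere R n).

Definition sphere_vec s : 'rV[R]_n.+1 := vec (sphere_val s).

Lemma vec_inj m : injective (@vec R m).
Proof.
move=> t t' /rowP tt; apply/eq_from_tnth => i.
by have := tt i; rewrite !mxE.
Qed.

Lemma dot_vec (t : n.+1.-tuple R) : dot (vec t) (vec t) = sqnorm t.
Proof. by apply: eq_bigr => i _; rewrite !mxE expr2. Qed.

Lemma nrm_sphere_vec s : nrm (sphere_vec s) = 1.
Proof. by rewrite /nrm dot_vec (eqP (valP s)) sqrtr1. Qed.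

Lemma scaled_sphere_vec_inj s s' (r r' : R) : 0 < r -> 0 < r' ->
  r *: sphere_vec s = r' *: sphere_vec s' -> s = s'.
Proof.
move=> r0 r'0 e; have rr : r = r'.
  have := congr1 nrm e; rewrite !nrmZ !nrm_sphere_vec !mulr1.
  by rewrite !gtr0_norm.
apply/val_inj/vec_inj; move: e; rewrite rr => /(congr1 (fun z => r'^-1 *: z)).
by rewrite !scalerA mulVf ?gt_eqF // !scale1r.
Qed.

Lemma polar_decomposition (x : 'rV[R]_n.+1) : x != 0 -> exists s, x = nrm x *: sphere_vec s.
Proof.
move=> x0; have n0 := nrm_gt0 x0.
pose t : n.+1.-tuple R := [tuple x 0 i / nrm x | i < n.+1].
have vt : vec t = (nrm x)^-1 *: x.
  by apply/rowP => i; rewrite !mxE tnth_mktuple mulrC.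
have t1 : sqnorm t == 1.
  by rewrite -dot_vec vt !dotE mulrA -expr2 -sqr_nrm -exprMn mulVf ?expr1n // gt_eqF.
exists (exist (fun x : n.+1.-tuple R => sqnorm x == 1) t t1).
have -> : sphere_vec (exist (fun x : n.+1.-tuple R => sqnorm x == 1) t t1) = vec t by [].
by rewrite vt scalerA divff ?scale1r // gt_eqF.
Qed.

(** Same points as c times [cone A], with equality of vectors instead of tuples. *)
Definition dilated_cone (c : R) A : set T :=
  [set t | exists2 s, A s & exists2 r : R, 0 < r <= c & vec t = r *: sphere_vec s].

Lemma cone_dilated_cone A : cone A = dilated_cone 1 A.
Proof.
apply/seteqP; split=> t [s As [r r1 e]]; exists s => //; exists r => //.
  by rewrite e; apply/rowP => i; rewrite !mxE tnth_mktuple.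
by apply: vec_inj; rewrite e; apply/rowP => i; rewrite !mxE tnth_mktuple.
Qed.

Lemma measurable_nrm_inv :
  measurable_fun setT (fun t : T => (nrm (vec t))^-1).
Proof.
rewrite (_ : (fun t : T => _) = fun t : T => sqnorm (t : n.+1.-tuple R) `^ (- 2^-1)).
  apply: (measurableT_comp (measurable_powR _)).
  apply: measurable_sum => i; apply: measurable_funX; exact: measurable_tnth.
apply/funext => t; rewrite powRN powR12_sqrt -?dot_vec //; exact: dot_ge0.
Qed.

Lemma measurable_dilated_cone1 A : measurable A -> measurable (dilated_cone 1 A).
Proof.
move=> [B mB]; rewrite setTI => BA.
pose ray (t : T) : T := [tuple tnth t i * (nrm (vec t))^-1 | i < n.+1].
have mray : measurable_fun setT ray.
  apply/measurable_fun_tnthP => i.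
  rewrite (_ : _ \o _ = fun t : T => tnth t i * (nrm (vec t))^-1); last first.
    by apply/funext => t /=; rewrite tnth_mktuple.
  apply: measurable_funM; [exact: measurable_tnth|exact: measurable_nrm_inv].
have rayE (r : R) s t : 0 < r -> vec t = r *: sphere_vec s -> ray t = sphere_val s.
  move=> r0 e; apply: vec_inj; apply/rowP => i; rewrite !mxE tnth_mktuple.
  have /rowP/(_ i) := e; rewrite !mxE => ->.
  by rewrite e nrmZ nrm_sphere_vec mulr1 gtr0_norm // mulrAC divff ?mul1r // gt_eqF.
rewrite (_ : dilated_cone 1 A = ray @^-1` B `&`
    [set t : T | nrm (vec t) != 0] `\` [set t : T | 1 < nrm (vec t)]).
  apply: measurableD; first apply: measurableI.
  - by rewrite -[X in measurable X]setTI; exact: mray.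
  - apply: (@euclid_open_measurable R n.+1 [set x | nrm x != 0]) => x x0.
    exists (nrm x); first by rewrite lt_neqAle eq_sym x0 nrm_ge0.
    move=> y yx /=; apply: contraTneq yx => y0; rewrite -leNgt.
    by have := nrmD (x - y) y; rewrite subrK y0 addr0 nrmB.
  - apply: (@euclid_open_measurable R n.+1 [set x | 1 < nrm x]) => x x0.
    exists (nrm x - 1); first by rewrite subr_gt0.
    move=> y yx /=; have := nrmD (x - y) y; rewrite subrK nrmB; lra.
apply/seteqP; split=> [t [s As [r /andP[r0 r1] e]]|t [[Bt t0] t1]].
  have nt : nrm (vec t) = r by rewrite e nrmZ nrm_sphere_vec mulr1 gtr0_norm.
  split; [split|] => /=.
  - by rewrite (rayE r s) //; move: As; rewrite -BA.
  - by rewrite nt gt_eqF.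
  - by rewrite nt; apply/negP; rewrite -leNgt.
have v0 : vec t != 0 by apply: contraNneq t0 => /= ->; rewrite nrm0.
have [s e] := polar_decomposition v0.
exists s; last first.
  exists (nrm (vec t)) => //; rewrite nrm_gt0 // leNgt; exact/negP.
by rewrite -BA /=; move: Bt; rewrite /preimage /= (rayE _ s _ _ e) // nrm_gt0.
Qed.

Lemma dilated_cone_scale (c : R) A : 0 < c ->
  dilated_cone c A = [set t : T | dilated_cone 1 A [tuple (c^-1 * tnth t i + 0)%R | i < n.+1]].
Proof.
move=> c0.
have E (t : T) : vec [tuple (c^-1 * tnth t i + 0)%R | i < n.+1] = c^-1 *: vec t.
  by apply/rowP => i; rewrite !mxE tnth_mktuple addr0.
apply/seteqP; split=> t [s As [r /andP[r0 r1] e]]; exists s => //.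
  exists (c^-1 * r); last by rewrite E e scalerA.
  by rewrite mulr_gt0 ?invr_gt0 //= mulrC ler_pdivrMr // mul1r.
exists (c * r); first by rewrite mulr_gt0 //= -[leRHS]mulr1 ler_pM2l.
by rewrite -scalerA -e E scalerA divff ?scale1r // gt_eqF.
Qed.

Lemma measurable_dilated_cone (c : R) A : 0 < c -> measurable A ->
  measurable (dilated_cone c A).
Proof.
move=> c0 mA; rewrite dilated_cone_scale //.
by apply: (measurable_affine c^-1 (fun=> 0)); exact: measurable_dilated_cone1.
Qed.

Lemma leb_dilated_cone (c : R) A : 0 < c -> measurable A ->
  leb (dilated_cone c A) = ((c ^+ n.+1)%:E * leb (cone A))%E.
Proof.
move=> c0 mA; rewrite cone_dilated_cone.
rewrite (@leb_affine _ _ c^-1 (fun=> 0) (dilated_cone 1 A)) ?invr_gt0 //; last first.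
  exact: measurable_dilated_cone1.
rewrite muleA -EFinM -exprMn divff ?gt_eqF // expr1n mul1e.
by rewrite dilated_cone_scale.
Qed.

Lemma surface_measureE A :
  surface_measure A = (n.+1%:R%:E * leb (cone A))%E.
Proof. by []. Qed.

Lemma cone_fin A : measurable A -> leb (cone A) \is a fin_num.
Proof.
move=> mA.
have : surface_measure A \is a fin_num by exact: (fin_num_measure (@surface_measure R n)).
rewrite surface_measureE !ge0_fin_numE ?mule_ge0 //.
apply: le_lt_trans; rewrite -[leLHS]mul1e.
by apply: lee_wpmul2r => //; rewrite lee_fin ler1n.
Qed.

(** The volume of the unit ball, since the cone over the whole sphere is the
    closed ball without its centre. *)
Definition omega : R := fine (leb (cone [set: sphere R n])).

Lemma omegaE : leb (cone [set: sphere R n]) = omega%:E.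
Proof. by rewrite /omega fineK // cone_fin. Qed.

Lemma vol_le_ball (K : set 'rV[R]_n.+1) (rho : R) : 0 < rho -> euclid_open K ->
  (forall x, K x -> nrm x <= rho) -> (vol K <= (rho ^+ n.+1 * omega)%:E)%E.
Proof.
move=> r0 oK Kr.
pose Z : set T := [set t | forall i, [set (0 : measurableTypeR R)] (tnth t i)].
have mZ : measurable Z.
  rewrite (_ : Z = \bigcap_(i in [set: 'I_n.+1])
      ((fun t : T => tnth t i) @^-1` [set (0 : measurableTypeR R)])).
    apply: fin_bigcap_measurable => // i _; rewrite -[X in measurable X]setTI.
    exact: measurable_tnth.
  by apply/seteqP; split => t h i; [move=> _|]; exact: h.
have Z0 : leb Z = 0%E.
  rewrite power_measure_box // big_ord_recl.
  apply/eqP; rewrite mule_eq0; apply/orP; left; apply/eqP.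
  exact: lebesgue_measure_set1.
rewrite EFinM -omegaE -leb_dilated_cone //.
rewrite -[leRHS]adde0 -Z0.
apply: le_trans (measureU2 _ (measurable_dilated_cone _ _) _) => //.
apply: le_measure; rewrite ?inE.
- exact: euclid_open_measurable.
- by apply: measurableU => //; exact: measurable_dilated_cone.
move=> t /= Kt.
have [v0|v0] := eqVneq (vec t) 0.
  by right => i; have /rowP/(_ i) := v0; rewrite !mxE.
left; have [s e] := polar_decomposition v0; exists s => //; exists (nrm (vec t)) => //.
by rewrite nrm_gt0 // Kr.
Qed.

(** The cube ]-1, 1[^(n+1) has positive volume and lies in a ball. *)
Lemma omega_gt0 : 0 < omega.
Proof.
pose K : set 'rV[R]_n.+1 := [set x | forall i, -1 < x 0 i < 1].
have oK : euclid_open K.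
  move=> x Kx.
  have [e e0 he] : exists2 e : R, 0 < e & forall i, e <= 1 - `|x 0 i|.
    exists (\big[Num.min/1]_i (1 - `|x 0 i|)).
      rewrite lt_bigmin // => i _; rewrite subr_gt0 ltr_norml; exact: Kx.
    by move=> i; exact: bigmin_le_cond.
  exists e => // y ye i; have := he i; have := coord_le_nrm (y - x) i.
  rewrite !mxE => h1 h2; rewrite -ltr_norml.
  have := ler_normD (y 0 i - x 0 i) (x 0 i); rewrite subrK; lra.
have := @vol_le_ball K n.+1%:R _ oK.
rewrite ltr0n => /(_ isT).
have -> : vol K = (2 ^+ n.+1)%:E.
  pose I1 : set (measurableTypeR R) := `]-1, 1[%classic.
  rewrite /vol (_ : [set t : T | K (vec t)] = [set t | forall i, I1 (tnth t i)]).
    rewrite power_measure_box; last exact: measurable_itv.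
    rewrite (eq_bigr (fun=> 2%:E)) ?prodEFin ?prodr_const ?card_ord // => i _.
    rewrite [LHS]lebesgue_measure_itv /= lte_fin -EFinD.
    by rewrite (_ : -1 < 1); [congr EFin; ring|lra].
  by apply/seteqP; split => t h i; have := h i; rewrite /I1 /= in_itv /= mxE.
rewrite lee_fin => H.
have : 0 < n.+1%:R ^+ n.+1 * omega.
  apply: (@lt_le_trans _ _ (2 ^+ n.+1)); first by rewrite exprn_gt0.
  apply: H => x Kx; rewrite -[leRHS]mulr1; apply: nrm_le_coord => // i.
  by apply: ltW; rewrite ltr_norml; exact: Kx.
by rewrite pmulr_rgt0 // exprn_gt0 // ltr0n.
Qed.

(** A set of larger volume than the ball of radius rho_j has a point outside that
    ball, and this remains true after any number of symmetrizations. *)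
Theorem det_prod_volumes (U : 'I_n.+1 -> set 'rV[R]_n.+1) (D : R)
    (s rho : 'I_n.+1 -> R) :
  (forall j, euclid_open (U j)) -> det_bounded U D -> (forall j, 0 < s j < rho j) ->
  (forall j, ((rho j ^+ n.+1 * omega)%:E < vol (U j))%E) ->
  \prod_j s j <= D.
Proof.
move=> oU UD srho volU.
have rho0 j : 0 < rho j by have /andP[h1 h2] := srho j; exact: lt_trans h2.
apply: (det_prod_radii (U := U) (rho := rho)) => // [j|j us us1].
  apply/set0P/negP => /eqP U0; have := volU j.
  rewrite U0 /vol (_ : [set t | _] = set0) ?measure0; last by apply/seteqP; split.
  by rewrite lte_fin ltNge mulr_ge0 // ?exprn_ge0 ?(ltW (rho0 j)) // ltW // omega_gt0.
have oC : euclid_open (symhull (U j)) by exact: symhull_open.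
apply: contrapT => N.
have : (vol (symmetrize us (symhull (U j))) <= (rho j ^+ n.+1 * omega)%:E)%E.
  apply: vol_le_ball => //.
    by apply: (@symmetrize_ind _ _ euclid_open) => // u C [u1 _]; exact: steiner_open.
  move=> x Kx; rewrite leNgt; apply/negP => h; apply: N; exists x => //; exact: ltW.
apply/negP; rewrite -ltNge; apply: lt_le_trans (volU j) _.
apply: le_trans (vol_symmetrize us1 oC).
apply: le_measure; rewrite ?inE; try exact: euclid_open_measurable.
by move=> t /= Ut; apply: sub_hull; left.
Qed.

End Cone.

(** * From almost everywhere bounds to sets in space *)

Lemma negligible_bigcup_fin d (T : measurableType d) (R : realType)
    (mu : {measure set T -> \bar R}) (I : finType) (F : I -> set T) :
  (forall i, mu.-negligible (F i)) -> mu.-negligible (\bigcup_i F i).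
Proof.
move=> F0; pose G k := if unpickle k is Some i then F i else set0.
apply: (@negligibleS _ _ _ _ (\bigcup_k G k)).
  by move=> x [i _ Fx]; exists (pickle i) => //; rewrite /G pickleK.
apply: negligible_bigcup => k; rewrite /G; case: unpickle => //.
exact: negligible_set0.
Qed.

Lemma rootK (R : realType) n (c : R) : 0 <= c -> (c `^ n.+1%:R^-1) ^+ n.+1 = c.
Proof.
by move=> c0; rewrite -powR_mulrn ?powR_ge0 // -powRrM mulVf ?powRr1 // pnatr_eq0.
Qed.

Section Thick.
Context {R : realType} {n : nat}.
Local Notation T := (n.+1.-tuple (measurableTypeR R)).
Local Notation leb := (power_measure (@lebesgue_measure R) (n:=n.+1)).
Local Notation S := (sphere R n).
Local Notation sigma := (@surface_measure R n).

Definition piece (h : S -> R) M f (c : R) : set S :=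
  h @^-1` [set c] `&` [set s | @grid_cell R n.+1 M f (sphere_vec s)].

Lemma measurable_grid_cell M f : measurable [set s : S | @grid_cell R n.+1 M f (sphere_vec s)].
Proof.
exists [set t : T | @grid_cell R n.+1 M f (vec t)].
  pose I i : set R := `[(f i)%:R, (f i).+1%:R[%classic.
  pose phi (i : 'I_n.+1) (t : T) : R := (@tnth _ R t i + 1) * M%:R.
  rewrite (_ : [set t | _] = \bigcap_(i in [set: 'I_n.+1]) (phi i @^-1` I i)).
    apply: fin_bigcap_measurable => // i _; rewrite -[X in measurable X]setTI.
    have : measurable_fun setT (phi i).
      apply: measurable_funM => //; apply: measurable_funD => //.
      exact: measurable_tnth.
    by apply => //; exact: measurable_itv.
  apply/seteqP; split => t h i.
    by move=> _; have := h i; rewrite /phi /I /= in_itv /= !mxE.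
  by have := h i Logic.I; rewrite /phi /I /= in_itv /= !mxE.
by rewrite setTI.
Qed.

(** An e-neighbourhood of the star-shaped set { r s : r^(n+1) <= h(s) },
    restricted to those points s that lie in a piece of positive measure. *)
Definition thick (h : S -> R) (M : nat) (e : R) : set 'rV[R]_n.+1 :=
  [set x | exists s r f, [/\ 0 < r, r ^+ n.+1 <= h s, @grid_cell R n.+1 M f (sphere_vec s),
     (0 < sigma (piece h f (h s)))%E & nrm (x - r *: sphere_vec s) < e]].

Lemma thick_open h M e : euclid_open (thick h M e).
Proof.
move=> x [s [r [f [r0 rh fs fpos xe]]]].
exists (e - nrm (x - r *: sphere_vec s)); first by rewrite subr_gt0.
move=> y yx; exists s, r, f; split => //.
have -> : y - r *: sphere_vec s = (y - x) + (x - r *: sphere_vec s) by rewrite addrA subrK.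
by apply: le_lt_trans (nrmD _ _) _; rewrite -ltrBrDr.
Qed.

Import HBNNSimple.

(** The pieces of measure zero are finitely many for each value of h, so dropping
    them loses nothing; each remaining level set { h = c } contributes the cone of
    height c^(1/(n+1)) over it, of volume c / (n+1) times its measure, and these
    cones are disjoint. *)
Lemma thick_vol (h : {nnsfun S >-> R}) M e : 0 < e ->
  (sintegral sigma h <= n.+1%:R%:E * vol (thick h M e))%E.
Proof.
move=> e0.
have mh (c : R) : measurable (h @^-1` [set c]).
  by rewrite -[X in measurable X]setTI; exact: measurable_funP.
have mp f c : measurable (@piece h M f c).
  by apply: measurableI => //; exact: measurable_grid_cell.
pose good c : set S := \bigcup_(f in [set f | (0 < sigma (@piece h M f c))%E]) piece h f c.
have mg c : measurable (good c) by apply: fin_bigcup_measurable.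
have good_full c : sigma (h @^-1` [set c]) = sigma (good c).
  apply/eqP; rewrite eq_le; apply/andP; split; last first.
    by apply: le_measure; rewrite ?inE // => s [f _ []].
  pose bad : set S := \bigcup_f
    (if (0 < sigma (@piece h M f c))%E then set0 else @piece h M f c).
  have mb : measurable bad by apply: fin_bigcup_measurable => // f _; case: ifP.
  have b0 : sigma bad = 0%E.
    apply: measure_negligible => //; apply: negligible_bigcup_fin => f.
    case: ifPn => [_|]; first exact: negligible_set0.
    rewrite -leNgt => h0; apply/negligibleP => //.
    by apply/eqP; rewrite eq_le h0 measure_ge0.
  rewrite -[leRHS]adde0 -b0; apply: le_trans (measureU2 _ (mg c) mb) => //.
  apply: le_measure; rewrite ?inE //; first exact: measurableU.
  move=> s hs; have [f fs] := grid_cell_cover M (nrm_sphere_vec s).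
  have [fpos|fnull] := boolP (0 < sigma (@piece h M f c))%E.
    by left; exists f.
  by right; exists f => //; rewrite (negbTE fnull).
pose K c := if 0 < c then dilated_cone (c `^ n.+1%:R^-1) (good c) else set0.
have mK c : measurable (K c).
  by rewrite /K; case: ifP => // c0; apply: measurable_dilated_cone => //; rewrite powR_gt0.
have fh : finite_set (range h) by exact: fimfunP.
rewrite sintegralE.
have -> : (\sum_(c \in range h) c%:E * sigma (h @^-1` [set c]) =
           \sum_(c \in range h) n.+1%:R%:E * leb (K c))%E.
  apply: eq_fsbigr => c /set_mem [s _ hs].
  have c0 : 0 <= c by rewrite -hs.
  have [->|cn0] := eqVneq c 0; first by rewrite mul0e /K ltxx measure0 mule0.
  have cp : 0 < c by rewrite lt_neqAle eq_sym cn0.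
  rewrite /K cp leb_dilated_cone ?powR_gt0 // rootK // [RHS]muleCA.
  exact: (congr1 (fun z => c%:E * z)%E (good_full c)).
rewrite -ge0_mule_fsumr //; apply: lee_wpmul2l => //.
have KE c t : K c t -> 0 < c /\ exists s (r : R) f, [/\ 0 < r, r ^+ n.+1 <= c, h s = c,
    @grid_cell R n.+1 M f (sphere_vec s) /\ (0 < sigma (@piece h M f c))%E &
    vec t = r *: sphere_vec s].
  rewrite /K; case: ifP => // c0 [s [f fpos [hs fs]] [r /andP[r0 rc] e1]]; split => //.
  exists s, r, f; split => //; rewrite -(rootK n (ltW c0)).
  by rewrite ler_pXn2r ?nnegrE ?powR_ge0 // ltW.
rewrite -measure_fin_bigcup //.
- apply: le_measure; rewrite ?inE //.
  + exact: fin_bigcup_measurable.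
  + by apply: euclid_open_measurable; exact: thick_open.
  + move=> t [c _ /KE [c0 [s [r [f [r0 rc hs [fs fpos] et]]]]]].
    by exists s, r, f; rewrite hs /= et subrr nrm0.
- apply/trivIsetP => c c' _ _ cc; apply/seteqP; split => // t [].
  move=> /KE [c0 [s [r [f [r0 _ hs _ et]]]]] /KE [_ [s' [r' [f' [r0' _ hs' _ et']]]]].
  have ss : s = s' by apply: (scaled_sphere_vec_inj r0 r0'); rewrite -et.
  by move/eqP : cc; rewrite -hs -hs' ss.
Qed.

End Thick.

Section PowerMeasure.
Context d (T : measurableType d) (R : realType).
Context (mu : {sigma_finite_measure set T -> \bar R}).

Lemma power_measure_prod n (A : 'I_n -> set T) : (forall i, measurable (A i)) ->
  (power_measure mu [set t : n.-tuple T | forall i, A i (tnth t i)] =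
   \prod_(i < n) mu (A i))%E.
Proof.
elim: n A => [|n IH] A mA.
  by rewrite big_ord0 /= diracE mem_set // => -[].
rewrite big_ord_recl /= -(IH (fun i => A (lift ord0 i))) //.
have <- : (\int[mu]_x (\1_(A ord0) x)%:E = mu (A ord0))%E.
  by rewrite integral_indic // setIT.
rewrite -ge0_integralZr //; last exact/measurable_EFinP/measurable_indic.
apply: eq_integral => x _; rewrite indicE.
have [xA|xA] := boolP (x \in A ord0).
  rewrite mul1e; congr (power_measure _ _); apply/seteqP; split => t /= h i.
    by have := h (lift ord0 i); rewrite tnthS.
  by case: (unliftP ord0 i) => [j ->|->]; rewrite ?tnthS ?tnth0 //; exact/set_mem.
rewrite mul0e -[RHS](measure0 (power_measure mu (n:=n))).
congr (power_measure _ _); apply/seteqP; split => t //= h.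
by have := h ord0; rewrite tnth0 => /mem_set; rewrite (negbTE xA).
Qed.

(** Otherwise the box, of positive measure, would be contained in a null set. *)
Lemma ae_meets_box n (A : 'I_n -> set T) (P : n.-tuple T -> Prop) :
  (forall i, measurable (A i)) -> (forall i, (0 < mu (A i))%E) ->
  (\forall t \ae power_measure mu (n:=n), P t) ->
  exists2 t, (forall i, A i (tnth t i)) & P t.
Proof.
move=> mA A0 Pae; apply: contrapT => N.
have mB : measurable [set t : n.-tuple T | forall i, A i (tnth t i)].
  rewrite (_ : [set _ | _] = \bigcap_(i in [set: 'I_n])
      ((fun t : n.-tuple T => tnth t i) @^-1` A i)).
    apply: fin_bigcap_measurable => // i _; rewrite -[X in measurable X]setTI.
    exact: measurable_tnth.
  by apply/seteqP; split => t h i; [move=> _|]; exact: h.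
have : power_measure mu [set t : n.-tuple T | forall i, A i (tnth t i)] = 0%E.
  apply/negligibleP => //; apply: negligibleS Pae => t At Pt; apply: N.
  by exists t.
rewrite power_measure_prod // => /eqP; apply/negP; rewrite gt_eqF //.
by elim/big_ind: _ => // x y; exact: mule_gt0.
Qed.

End PowerMeasure.

Lemma powR_prod (R : realType) (I : finType) (a : I -> R) (p : R) :
  (forall i, 0 <= a i) -> (\prod_i a i) `^ p = \prod_i a i `^ p.
Proof.
move=> a0; suff [] : (\prod_i a i) `^ p = \prod_i a i `^ p /\ 0 <= \prod_i a i by [].
apply: (big_rec2 (fun x y => x `^ p = y /\ 0 <= x)); first by rewrite powR1.
by move=> i x y _ [<- x0]; rewrite powRM // mulr_ge0.
Qed.

Section Integrals.
Context {R : realType} {n : nat}.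
Local Notation S := (sphere R n).
Local Notation sigma := (@surface_measure R n).
Import HBNNSimple.

Lemma absdetE (t : n.+1.-tuple S) : absdet t = `|row_det (fun j => sphere_vec (tnth t j))|.
Proof.
rewrite /absdet /row_det -det_tr; congr (`|\det _|); apply/matrixP => i j.
by rewrite !mxE.
Qed.

Lemma row_det_scale (r : 'I_n.+1 -> R) (x : 'I_n.+1 -> 'rV[R]_n.+1) :
  row_det (fun j => r j *: x j) = (\prod_j r j) * row_det x.
Proof.
rewrite /row_det (_ : \matrix_i _ = diag_mx (\row_j r j) *m \matrix_i x i).
  rewrite det_mulmx det_diag; congr (_ * _).
  by apply: eq_bigr => i _; rewrite mxE.
by apply/matrixP => i k; rewrite mul_diag_mx !mxE.
Qed.

(** Comparison of (n+1)-th powers. *)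
Lemma frame_bound (F r : 'I_n.+1 -> R) (a p m : R) :
  0 < p -> 0 <= a -> (forall j, 0 <= F j) -> (forall j, 0 <= r j) ->
  (forall j, r j ^+ n.+1 <= F j `^ p) ->
  (\prod_j F j) * a `^ (n.+1%:R / p) <= m ->
  (\prod_j r j) * a <= m `^ (p / n.+1%:R).
Proof.
move=> p0 a0 F0 r0 rF Fm.
have pF : 0 <= \prod_j F j by apply: prodr_ge0.
have pr : 0 <= \prod_j r j by apply: prodr_ge0.
have m0 : 0 <= m by apply: le_trans Fm; rewrite mulr_ge0 // powR_ge0.
rewrite -(@ler_pXn2r _ n.+1) ?nnegrE ?powR_ge0 ?mulr_ge0 //.
rewrite -[leRHS]powR_mulrn ?powR_ge0 // -[leRHS]powRrM divfK ?pnatr_eq0 //.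
apply: (@le_trans _ _ (((\prod_j F j) * a `^ (n.+1%:R / p)) `^ p)); last first.
  by apply: ge0_ler_powR; rewrite ?nnegrE ?(ltW p0) ?mulr_ge0 ?powR_ge0.
rewrite powRM ?powR_ge0 // -powRrM divfK ?gt_eqF // powR_mulrn // exprMn.
apply: ler_wpM2r; first by rewrite exprn_ge0.
rewrite powR_prod // -prodrXl; apply: ler_prod => j _.
by rewrite exprn_ge0 //= rF.
Qed.

(** Points x_j of the thickened sets lie over pieces of positive measure.  The
    product of these pieces contains a tuple t satisfying the bound, and the
    vectors r_j t_j are close to the x_j because pieces are small. *)
Lemma thick_det (p m e B : R) (F : 'I_n.+1 -> S -> R)
    (h : 'I_n.+1 -> {nnsfun S >-> R}) M :
  0 < p -> 0 < e <= 1 -> 1 <= B -> (0 < M)%N -> n.+1%:R / M%:R < e ->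
  (forall j s, 0 <= F j s) -> (forall j s, h j s <= F j s `^ p) ->
  (forall j s, h j s <= B) ->
  (\forall t \ae power_measure sigma (n:=n.+1),
     (\prod_j F j (tnth t j)) * absdet t `^ (n.+1%:R / p) <= m) ->
  det_bounded (fun j => thick (h j) M e)
    (m `^ (p / n.+1%:R) + n.+1%:R * ((e * (1 + B)) * (B + 1) ^+ n.+1)).
Proof.
move=> p0 /andP[e0 e1] B1 M0 Me F0 hF hB Fm x xU.
have [s hs] := choice xU; have [r hr] := choice hs; have [f {xU hs}hf] := choice hr.
have B0 : 0 <= B := le_trans ler01 B1.
have r0 j : 0 < r j by have [] := hf j.
have rB j : r j <= B.
  have [_ h1 _ _ _] := hf j; rewrite leNgt; apply/negP => Br.
  have : B < r j ^+ n.+1.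
    apply: (lt_le_trans Br); apply: ler_eXnr => //.
    exact: ltW (le_lt_trans B1 Br).
  by apply/negP; rewrite -leNgt (le_trans h1).
have [||t tp /= tm] := @ae_meets_box _ _ _ sigma _
  (fun j => piece (h j) (f j) (h j (s j))) _ _ _ Fm.
- move=> j; apply: measurableI; last exact: measurable_grid_cell.
  by rewrite -[X in measurable X]setTI; exact: measurable_funP.
- by move=> j; have [] := hf j.
pose y j := r j *: sphere_vec (tnth t j).
have dy : `|row_det y| <= m `^ (p / n.+1%:R).
  rewrite /y row_det_scale normrM -absdetE ger0_norm; last first.
    by apply: prodr_ge0 => j _; exact: ltW.
  apply: frame_bound tm => // [|j|j]; first exact: normr_ge0.
    exact: ltW.
  have [_ h1 _ _ _] := hf j; have [h2 _] := tp j.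
  by apply: le_trans h1 _; rewrite -h2; exact: hF.
have xy j : nrm (x j - y j) <= e * (1 + B).
  have [_ _ h2 _ h3] := hf j; have [_ h4] := tp j.
  have -> : x j - y j =
      (x j - r j *: sphere_vec (s j)) + r j *: (sphere_vec (s j) - sphere_vec (tnth t j)).
    by rewrite scalerBr addrA subrK.
  apply: le_trans (nrmD _ _) _.
  rewrite mulrDr mulr1 lerD ?(ltW h3) // nrmZ gtr0_norm // mulrC.
  apply: ler_pM; rewrite ?nrm_ge0 ?(ltW (r0 j)) //.
  by apply: ltW; apply: le_lt_trans Me; exact: grid_cell_diam h4.
have yB j : nrm (y j) <= B + 1.
  by rewrite /y nrmZ nrm_sphere_vec mulr1 gtr0_norm //; have := rB j; lra.
have xB j : nrm (x j) <= B + 1.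
  have [_ _ _ _ h3] := hf j.
  have -> : x j = (x j - r j *: sphere_vec (s j)) + r j *: sphere_vec (s j) by rewrite subrK.
  apply: le_trans (nrmD _ _) _; rewrite nrmZ nrm_sphere_vec mulr1 gtr0_norm //.
  have := rB j; lra.
apply: le_trans (row_det_perturb _ xB yB xy) _; first by lra.
by rewrite lerD2r.
Qed.

(** F_j^p is approximated from below by a simple function, then the mesh and the
    thickening tend to 0. *)
Lemma det_prod_integrals (p m : R) (F : 'I_n.+1 -> S -> R) (s rho : 'I_n.+1 -> R) :
  0 < p -> (forall j x, 0 <= F j x) ->
  (\forall t \ae power_measure sigma (n:=n.+1),
     (\prod_j F j (tnth t j)) * absdet t `^ (n.+1%:R / p) <= m) ->
  (forall j, 0 < s j < rho j) ->
  (forall j, ((rho j ^+ n.+1 * (n.+1%:R * omega (R:=R) (n:=n)))%:E <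
     \int[sigma]_x (F j x `^ p)%:E)%E) ->
  \prod_j s j <= m `^ (p / n.+1%:R).
Proof.
move=> p0 F0 Fm srho FI.
have hex j : exists h : {nnsfun S >-> R}, (forall x, h x <= F j x `^ p) /\
    ((rho j ^+ n.+1 * (n.+1%:R * omega (R:=R) (n:=n)))%:E < sintegral sigma h)%E.
  have := FI j; rewrite ge0_integralTE; last by move=> x; rewrite lee_fin powR_ge0.
  move=> /ereal_sup_gt[y [h hF hy] hI]; exists h; split; last by rewrite hy.
  by move=> x; have := hF x; rewrite lee_fin.
have [h hh] := choice hex.
have hb j : exists b, forall x, h j x <= b.
  have [b [_ hb]] := simple_bounded (h j).
  exists (b + 1) => x; apply: le_trans (ler_norm _) _.
  by apply: hb => //; rewrite ltrDl.
have [b hb'] := choice hb.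
pose B := \big[Num.max/1]_j b j.
have B1 : 1 <= B by exact: bigmax_ge_id.
have hB j x : h j x <= B by apply: le_trans (hb' j x) _; exact: le_bigmax.
(* [thick_det] leaves the error e C *)
pose C := n.+1%:R * ((1 + B) * (B + 1) ^+ n.+1).
have C0 : 0 < C by rewrite !mulr_gt0 ?exprn_gt0 //; lra.
apply/ler_addgt0Pr => eps eps0.
pose e := Num.min 1 (eps / C).
have e0 : 0 < e by rewrite lt_min ltr01 divr_gt0.
have e1 : e <= 1 by rewrite ge_min lexx.
have [M M0 Me] := @grid_cell_fine R n.+1 e e0.
have e01 : 0 < e <= 1 by rewrite e0.
have hF j x : h j x <= F j x `^ p by have [+ _] := hh j; apply.
have UD := thick_det p0 e01 B1 M0 Me F0 hF hB Fm.
apply: (le_trans (det_prod_volumes _ UD srho _)).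
- by move=> j; exact: thick_open.
- move=> j; have [_ h1] := hh j.
  have := lt_le_trans h1 (thick_vol (h j) M e0).
  rewrite mulrCA EFinM lte_pmul2l //; by rewrite lte_fin ltr0n.
rewrite lerD2l.
have -> : n.+1%:R * (e * (1 + B) * (B + 1) ^+ n.+1) = e * C by rewrite /C; ring.
by rewrite -ler_pdivlMr // ge_min lexx orbT.
Qed.

End Integrals.

(** * The sharp inequality and its constant *)

Section Main.
Context {R : realType} {n : nat}.
Local Notation S := (sphere R n).
Local Notation sigma := (@surface_measure R n).
Implicit Types (p m : R).

Definition sphere_area : R := n.+1%:R * omega (R:=R) (n:=n).

Lemma sphere_area_gt0 : 0 < sphere_area.
Proof. by rewrite mulr_gt0 // omega_gt0. Qed.

Lemma surface_setT : sigma [set: S] = sphere_area%:E.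
Proof. by rewrite surface_measureE omegaE -EFinM. Qed.

Lemma power_surface_gt0 : (0 < power_measure sigma [set: n.+1.-tuple S])%E.
Proof.
rewrite (_ : setT = [set t : n.+1.-tuple S | forall i, [set: S] (tnth t i)]); last first.
  by apply/seteqP; split.
rewrite (@power_measure_prod _ _ _ sigma _ (fun=> setT)) //.
elim/big_ind: _ => // [x y|i _]; first exact: mule_gt0.
by have := sphere_area_gt0; rewrite -lte_fin -surface_setT.
Qed.

(** Apply the hypothesis to t with t^(k+1) = (D + X) / (2 X). *)
Lemma le_of_contractions (k : nat) (X D : R) : 0 <= D ->
  (forall t, 0 < t < 1 -> t ^+ k.+1 * X <= D) -> X <= D.
Proof.
move=> D0 H; rewrite leNgt; apply/negP => DX.
have X0 : 0 < X := le_lt_trans D0 DX.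
pose E := (D + X) / 2.
have E0 : 0 < E by rewrite /E; lra.
have EX0 : 0 < E / X by rewrite divr_gt0.
pose t := (E / X) `^ k.+1%:R^-1.
have tk : t ^+ k.+1 = E / X by rewrite rootK // ltW.
have t0 : 0 < t by rewrite powR_gt0.
have t1 : t < 1.
  rewrite -(@ltr_pXn2r _ k.+1) ?nnegrE ?(ltW t0) // expr1n tk ltr_pdivrMr // mul1r.
  by rewrite /E; lra.
have := H t; rewrite t0 t1 tk divfK ?gt_eqF // => /(_ isT); rewrite /E; lra.
Qed.

(** The radii k_j with k_j^(n+1) w = i_j are limits of admissible pairs
    s_j = t^2 k_j < rho_j = t k_j as t tends to 1. *)
Lemma prod_le_of_radii (i : 'I_n.+1 -> R) (w p m : R) :
  0 < w -> 0 < p -> 0 <= m -> (forall j, 0 <= i j) ->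
  (forall s rho : 'I_n.+1 -> R, (forall j, 0 < s j < rho j) ->
     (forall j, rho j ^+ n.+1 * w < i j) -> \prod_j s j <= m `^ (p / n.+1%:R)) ->
  \prod_j i j `^ p^-1 <= w `^ (n.+1%:R / p) * m.
Proof.
move=> w0 p0 m0 i0 H.
have [[j ij]|N] := pselect (exists j, i j = 0).
  rewrite (bigD1 j) //= ij powR0 ?invr_eq0 ?gt_eqF // mul0r.
  by rewrite mulr_ge0 // powR_ge0.
have {}i0 j : 0 < i j.
  by rewrite lt_neqAle i0 andbT eq_sym; apply/eqP => ij; apply: N; exists j.
pose k j := (i j / w) `^ n.+1%:R^-1.
have k0 j : 0 < k j by rewrite powR_gt0 // divr_gt0.
have kE j : k j ^+ n.+1 * w = i j.
  by rewrite rootK ?divfK ?gt_eqF // ltW // divr_gt0.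
have kD : \prod_j k j <= m `^ (p / n.+1%:R).
  apply: (@le_of_contractions (n + n.+1)); first exact: powR_ge0.
  move=> t /andP[t0 t1].
  have := H (fun j => t * (t * k j)) (fun j => t * k j).
  rewrite !big_split /= !prodr_const card_ord mulrA -exprD addSn; apply.
    by move=> j; rewrite !mulr_gt0 //= gtr_pMl // mulr_gt0.
  move=> j; rewrite exprMn -mulrA kE gtr_pMl // exprn_ilt1 // ltW //.
have -> : \prod_j i j `^ p^-1 = w `^ (n.+1%:R / p) * (\prod_j k j) `^ (n.+1%:R / p).
  rewrite powR_prod; last by move=> j; exact: ltW.
  rewrite powRrM mulrC -powRAC powR_mulrn ?powR_ge0 //.
  rewrite -[X in _ * _ ^+ X](card_ord n.+1) -prodr_const -big_split /=.
  apply: eq_bigr => j _; rewrite powRrM powR_mulrn ?(ltW (k0 j)) //.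
  by rewrite -powRM ?kE // ?exprn_ge0 ?(ltW (k0 j)) // ltW.
apply: ler_wpM2l; first exact: powR_ge0.
apply: (@le_trans _ _ ((m `^ (p / n.+1%:R)) `^ (n.+1%:R / p))).
  apply: ge0_ler_powR; rewrite ?nnegrE ?powR_ge0 ?divr_ge0 ?(ltW p0) //.
  by apply: prodr_ge0 => j _; exact: ltW.
rewrite -powRrM (_ : p / n.+1%:R * (n.+1%:R / p) = 1) ?powRr1 //.
by rewrite mulrA divfK ?pnatr_eq0 // divff // gt_eqF.
Qed.

Lemma Lnorm_ge0E p (F : S -> R) : 0 < p -> (forall x, 0 <= F x) ->
  ('N[sigma]_p%:E[EFin \o F] = (\int[sigma]_x (F x `^ p)%:E) `^ p^-1)%E.
Proof.
move=> p0 F0; rewrite unlock; congr (_ `^ _)%E; apply: eq_integral => x _ /=.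
by rewrite ger0_norm.
Qed.

Lemma absdet_le1 (t : n.+1.-tuple S) : absdet t <= 1.
Proof.
rewrite absdetE; apply: le_trans (hadamard _) _.
by rewrite big1 // => j _; exact: nrm_sphere_vec.
Qed.

Lemma absdet_ge0 (t : n.+1.-tuple S) : 0 <= absdet t.
Proof. exact: normr_ge0. Qed.

Lemma det_sup_ge0 p (F : 'I_n.+1 -> S -> R) :
  (forall j x, 0 <= F j x) -> (0 <= det_sup p F)%E.
Proof.
move=> F0; apply: ess_sup_gee; first exact: power_surface_gt0.
by apply: aeW => t; rewrite lee_fin mulr_ge0 ?powR_ge0 // prodr_ge0.
Qed.

Lemma sharp_det_inequality p : 0 < p ->
  det_inequality n p (sphere_area `^ (n.+1%:R / p)).
Proof.
move=> p0 F F0 Ffin.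
have B0 : 0 < sphere_area `^ (n.+1%:R / p) by rewrite powR_gt0 // sphere_area_gt0.
have M0 : (0 <= det_sup p F)%E by exact: det_sup_ge0.
have [MNy|Mfin] := eqVneq (det_sup p F) +oo%E.
  by rewrite MNy gt0_muley ?lte_fin // leey.
have {}Mfin : det_sup p F \is a fin_num by rewrite ge0_fin_numE // lt_neqAle Mfin leey.
pose m := fine (det_sup p F).
have mE : det_sup p F = m%:E by rewrite fineK.
have m0 : 0 <= m by rewrite -lee_fin -mE.
have Fm : \forall t \ae power_measure sigma (n:=n.+1),
    (\prod_j F j (tnth t j)) * absdet t `^ (n.+1%:R / p) <= m.
  have := @ess_sup_ge _ _ _ (power_measure sigma (n:=n.+1))
    (fun s => ((\prod_(j < n.+1) F j (tnth s j)) * absdet s `^ (n.+1%:R / p))%:E).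
  by apply: filterS => t; rewrite -lee_fin -mE.
pose I j := (\int[sigma]_x (F j x `^ p)%:E)%E.
have I0 j : (0 <= I j)%E by apply: integral_ge0 => x _; rewrite lee_fin powR_ge0.
have Ifin j : I j \is a fin_num.
  rewrite ge0_fin_numE // ltey; apply/eqP => Iy; have := Ffin j.
  by rewrite /finite_norm Lnorm_ge0E // -/(I j) Iy poweRyr ?invr_eq0 ?gt_eqF.
have IE j : I j = (fine (I j))%:E by rewrite fineK.
have -> : prod_Lnorm p F = (\prod_j fine (I j) `^ p^-1)%:E.
  rewrite /prod_Lnorm -prodEFin; apply: eq_bigr => j _.
  by rewrite Lnorm_ge0E // -/(I j) IE poweR_EFin.
rewrite mE -EFinM lee_fin; apply: prod_le_of_radii => //.
- exact: sphere_area_gt0.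
- by move=> j; rewrite fine_ge0.
move=> s rho srho hI; apply: (det_prod_integrals p0 F0 Fm srho) => j.
by rewrite -/(I j) IE lte_fin.
Qed.

Lemma Lnorm_sphere_cst p (c : R) : 0 < p -> 0 < c ->
  ('N[sigma]_p%:E[EFin \o (cst c : S -> R)] = (sphere_area `^ p^-1 * c)%R%:E)%E.
Proof.
move=> p0 c0; rewrite Lnorm_ge0E // => [|x]; last exact: ltW.
have -> : (\int[sigma]_x (cst c x `^ p)%:E = (c `^ p * sphere_area)%R%:E)%E.
  by rewrite EFinM -surface_setT -integral_cst //; exact: eq_integral.
rewrite poweR_EFin powRM ?powR_ge0 ?(ltW sphere_area_gt0) // mulrC.
by rewrite -powRrM divff ?gt_eqF // powRr1 // ltW.
Qed.

Lemma prod_Lnorm_cst p (c : 'I_n.+1 -> R) : 0 < p -> (forall j, 0 < c j) ->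
  prod_Lnorm p (fun j => cst (c j) : S -> R) =
  (sphere_area `^ (n.+1%:R / p) * \prod_j c j)%:E.
Proof.
move=> p0 c0.
rewrite /prod_Lnorm (eq_bigr (fun j => (sphere_area `^ p^-1 * c j)%:E)).
  rewrite prodEFin big_split /= prodr_const card_ord -powR_mulrn ?powR_ge0 //.
  by rewrite -powRrM [p^-1 * _]mulrC.
by move=> j _; exact: Lnorm_sphere_cst.
Qed.

(** The upper bound is Hadamard's inequality; the lower bound is the sharp
    inequality itself, applied to constants. *)
Lemma det_sup_cst p (c : 'I_n.+1 -> R) : 0 < p -> (forall j, 0 < c j) ->
  det_sup p (fun j => cst (c j) : S -> R) = (\prod_j c j)%:E.
Proof.
move=> p0 c0; apply/eqP; rewrite eq_le; apply/andP; split.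
  apply/ess_supP; apply: aeW => t; rewrite lee_fin ler_piMr //.
    by apply: prodr_ge0 => j _; exact: (ltW (c0 j)).
  have one : 1 `^ (n.+1%:R / p) = 1 :> R by rewrite powR1.
  rewrite -[leRHS]one; apply: ge0_ler_powR.
  - by rewrite divr_ge0 // ltW.
  - by rewrite nnegrE absdet_ge0.
  - by rewrite nnegrE.
  - exact: absdet_le1.
have := @sharp_det_inequality p p0 (fun j => [the {mfun S >-> R} of cst (c j)]).
rewrite prod_Lnorm_cst // EFinM lee_pmul2l ?lte_fin ?powR_gt0 ?sphere_area_gt0 //; apply.
  by move=> j x; exact: (ltW (c0 j)).
by move=> j; rewrite /finite_norm Lnorm_sphere_cst // ltry.
Qed.

End Main.

Theorem theorem4p10 (R : realType) (n : nat) (p : R)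
    (n_ge1 : (1 <= n)%N) (p_gt0 : 0 < p) :
  exists B : R,
    [/\ det_inequality n p B,
        (forall B' : R, det_inequality n p B' -> B <= B'),
        (forall c : 'I_n.+1 -> R, (forall j, 0 < c j) ->
           prod_Lnorm p (fun j => cst (c j) : sphere R n -> R) =
           (B%:E * det_sup p (fun j => cst (c j) : sphere R n -> R))%E) &
        B%:E = (@surface_measure R n [set: sphere R n] `^ (n.+1%:R / p))%E].
Proof.
exists (sphere_area (R:=R) (n:=n) `^ (n.+1%:R / p)); split.
- exact: sharp_det_inequality.
- move=> B' HB'.
  have c1 : forall j : 'I_n.+1, (0 : R) < 1 by [].
  have := HB' (fun j => [the {mfun sphere R n >-> R} of cst 1]).
  rewrite (prod_Lnorm_cst p_gt0 c1) (det_sup_cst p_gt0 c1) -EFinM lee_fin.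
  rewrite prodr_const expr1n !mulr1; apply; first by move=> j x; exact: ler01.
  by move=> j; rewrite /finite_norm Lnorm_sphere_cst // ltry.
- by move=> c c0; rewrite prod_Lnorm_cst // det_sup_cst // -EFinM.
- by rewrite surface_setT poweR_EFin.
Qed.
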